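(* Let $\Gamma$ be a finite connected graph of infinite cyclic groups (a graph of groups in which every vertex group and every edge group is isomorphic to $\mathbb{Z}$), and let $G$ be the Generalized Baumslag-Solitar group defined by $\Gamma$, i.e. the fundamental group of this graph of groups. Then $\mathrm{CL}_G(n)\simeq n$.
   Context: Graphs of groups and their fundamental groups are in the sense of Serre (edge groups inject into the vertex groups at their endpoints; the fundamental group is taken with respect to a spanning tree and is independent of it up to isomorphism). For a group $G=\langle X\mid R\rangle$ with finite presentation, $|g|$ denotes the word length of $g\in G$ with respect to $X^{\pm1}$. For conjugate $u,v\in G$ put $c(u,v)=\min\{|\gamma| : \gamma u\gamma^{-1}=v\}$. The conjugator length function is $\mathrm{CL}_G(n)=\max c(u,v)$, the maximum being over all conjugate pairs $u,v\in G$ with $|u|+|v|\le n$. For non-decreasing $f,g:\mathbb{N}\to\mathbb{N}$ write $f(n)\preceq g(n)$ if there is $C>0$ with $f(n)\le C g(Cn+C)+Cn+C$ for all $n\in\mathbb{N}$, and $f(n)\simeq g(n)$ if $f\preceq g$ and $g\preceq f$; up to $\simeq$, $\mathrm{CL}_G$ does not depend on the finite presentation. *)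

(* Defs.v *)
From HB Require Import structures.
From mathcomp Require Import all_boot all_order all_algebra.
From mathcomp Require Import generic_quotient boolp classical_sets.

Set Implicit Arguments.
Unset Strict Implicit.
Unset Printing Implicit Defensive.

Local Open Scope group_scope.
Local Open Scope quotient_scope.

Definition isomorphism (G H : groupType) (f : G -> H) : Prop :=
  {morph f : x y / x * y} /\ bijective f.

(* G is isomorphic to the additive group of integers. *)
Definition infinite_cyclic (G : groupType) : Prop :=
  exists2 f : int -> G, bijective f & {morph f : m n / (m + n)%R >-> m * n}.

(* A letter (x, b) stands for x if b = false and for the inverse of x if
   b = true. *)
Notation word X := (seq (X * bool)).

Definition winv (X : Type) (w : word X) : word X :=
  [seq (l.1, ~~ l.2) | l <- rev w].

Inductive pres_eq (X : Type) (R : set (word X)) : word X -> word X -> Prop :=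
| pres_refl w : pres_eq R w w
| pres_sym w1 w2 : pres_eq R w1 w2 -> pres_eq R w2 w1
| pres_trans w1 w2 w3 : pres_eq R w1 w2 -> pres_eq R w2 w3 -> pres_eq R w1 w3
| pres_cat w1 w2 w1' w2' :
    pres_eq R w1 w1' -> pres_eq R w2 w2' -> pres_eq R (w1 ++ w2) (w1' ++ w2')
| pres_cancel x b : pres_eq R [:: (x, b); (x, ~~ b)] [::]
| pres_relator r : R r -> pres_eq R r [::].

Section PresentedGroup.
Variables (X : choiceType) (R : set (word X)).

Definition pres_eqb (w1 w2 : word X) : bool := `[< pres_eq R w1 w2 >].

Lemma pres_eqb_refl : reflexive pres_eqb.
Proof. by move=> w; apply/asboolP; exact: pres_refl. Qed.

Lemma pres_eqb_sym : symmetric pres_eqb.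
Proof. by move=> w1 w2; apply/asboolP/asboolP; exact: pres_sym. Qed.

Lemma pres_eqb_trans : transitive pres_eqb.
Proof.
by move=> w2 w1 w3 /asboolP h1 /asboolP h2; apply/asboolP; exact: pres_trans h2.
Qed.

Canonical pres_equiv := EquivRel pres_eqb pres_eqb_refl pres_eqb_sym pres_eqb_trans.

(* The group < X | R >. *)
Definition presented : Type := {eq_quot pres_equiv}.
HB.instance Definition _ := Choice.on presented.

Definition word_class (w : word X) : presented := \pi_{eq_quot pres_equiv} w.

Lemma word_classP w1 w2 : word_class w1 = word_class w2 <-> pres_eq R w1 w2.
Proof.
split=> [/eqquotP/asboolP//|h].
by apply/eqquotP/asboolP.
Qed.

Definition presented_repr (a : presented) : word X :=
  repr (a : {eq_quot pres_equiv}).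

Lemma presented_reprK a : word_class (presented_repr a) = a.
Proof. exact: reprK. Qed.

Definition presented_one : presented := word_class [::].
Definition presented_mul (a b : presented) : presented :=
  word_class (presented_repr a ++ presented_repr b).
Definition presented_inv (a : presented) : presented :=
  word_class (winv (presented_repr a)).

Lemma presented_mulE w1 w2 :
  presented_mul (word_class w1) (word_class w2) = word_class (w1 ++ w2).
Proof.
by apply/word_classP; apply: pres_cat; apply/word_classP; exact: presented_reprK.
Qed.

Lemma pres_mulwV (w : word X) : pres_eq R (w ++ winv w) [::].
Proof.
elim: w => [|[x b] w IH]; first exact: pres_refl.
rewrite /winv rev_cons map_rcons -cats1 /= -/(winv w) -cat_cons catA.
apply: (pres_trans (w2 := [:: (x, b)] ++ [::] ++ [:: (x, ~~ b)])).
  rewrite -cat1s -!catA; apply: pres_cat; first exact: pres_refl.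
  by rewrite catA; apply: pres_cat => //; exact: pres_refl.
exact: pres_cancel.
Qed.

Lemma winvK (w : word X) : winv (winv w) = w.
Proof.
rewrite /winv -map_rev revK -map_comp -[RHS]map_id.
by apply: eq_map => -[x b] /=; rewrite negbK.
Qed.

Lemma presented_mulA : associative presented_mul.
Proof.
move=> a b c.
rewrite -(presented_reprK a) -(presented_reprK b) -(presented_reprK c).
by rewrite !presented_mulE catA.
Qed.

Lemma presented_mul1 : left_id presented_one presented_mul.
Proof. by move=> a; rewrite -(presented_reprK a) presented_mulE. Qed.

Lemma presented_mulr1 : right_id presented_one presented_mul.
Proof. by move=> a; rewrite -(presented_reprK a) presented_mulE cats0. Qed.

Lemma presented_mulV : left_inverse presented_one presented_inv presented_mul.
Proof.
move=> a; rewrite -{2}(presented_reprK a) presented_mulE; apply/word_classP.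
by rewrite -{2}(winvK (presented_repr a)); exact: pres_mulwV.
Qed.

Lemma presented_mulrV : right_inverse presented_one presented_inv presented_mul.
Proof.
move=> a; rewrite -{1}(presented_reprK a) presented_mulE; apply/word_classP.
exact: pres_mulwV.
Qed.

HB.instance Definition _ := isGroup.Build presented presented_mulA
  presented_mul1 presented_mulr1 presented_mulV presented_mulrV.

End PresentedGroup.

(* The geometric edges of the finite graph carry an arbitrary orientation, from
   src e to tgt e; Serre's oriented edges are the pairs (e, b) below, with
   (e, true) the reverse of (e, false). Loops and multiple edges are allowed.
   The two embeddings of an edge group are thus both defined on one group. *)
Record graph_of_groups := GraphOfGroups {
  vert : finType;
  edge : finType;
  src : edge -> vert;
  tgt : edge -> vert;
  vgrp : vert -> groupType;
  egrp : edge -> groupType;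
  emb_src : forall e, egrp e -> vgrp (src e);
  emb_tgt : forall e, egrp e -> vgrp (tgt e);
  emb_srcM : forall e, {morph @emb_src e : a b / a * b};
  emb_tgtM : forall e, {morph @emb_tgt e : a b / a * b};
  emb_src_inj : forall e, injective (@emb_src e);
  emb_tgt_inj : forall e, injective (@emb_tgt e) }.

Section Graph.
Variable Gam : graph_of_groups.
Implicit Type T : {set edge Gam}.

Definition dart : finType := (edge Gam * bool)%type.
Definition dsrc (d : dart) : vert Gam := if d.2 then tgt d.1 else src d.1.
Definition dtgt (d : dart) : vert Gam := if d.2 then src d.1 else tgt d.1.
Definition drev (d : dart) : dart := (d.1, ~~ d.2).

Definition adj T : rel (vert Gam) :=
  fun u v => [exists d : dart, [&& d.1 \in T, dsrc d == u & dtgt d == v]].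

(* All vertices are kept; the edges are those in T. *)
Definition connected_by T : Prop :=
  inhabited (vert Gam) /\ forall u v, connect (adj T) u v.

Definition graph_connected : Prop := connected_by [set: edge Gam].

(* A closed path without backtracking with distinct vertices; length 1 (a loop)
   and length 2 (a double edge) are allowed. *)
Definition circuit (c : seq dart) : bool :=
  [&& c != [::], cycle [rel d d' | (dtgt d == dsrc d') && (d' != drev d)] c
    & uniq (map dtgt c)].

Definition spanning_tree T : Prop :=
  connected_by T /\
  forall c : seq dart, circuit c -> ~ {in c, forall d, d.1 \in T}.

Definition pi1_gen : choiceType := ({v : vert Gam & vgrp v} + edge Gam)%type.

Definition vletter v (g : vgrp v) : pi1_gen * bool := (inl (Tagged (@vgrp Gam) g), false).
Definition eletter (e : edge Gam) (b : bool) : pi1_gen * bool := (inr e, b).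

Inductive pi1_rel T : word pi1_gen -> Prop :=
| pi1_vertex v (g h : vgrp v) :
    pi1_rel T ([:: vletter g; vletter h] ++ winv [:: vletter (g * h)])
| pi1_edge e (a : egrp e) :
    pi1_rel T ([:: eletter e false; vletter (emb_tgt a); eletter e true]
               ++ winv [:: vletter (emb_src a)])
| pi1_tree e : e \in T -> pi1_rel T [:: eletter e false].

Definition pi1 T : groupType := presented (pi1_rel T).

End Graph.

Record fin_presentation (G : groupType) := FinPresentation {
  ngens : nat;
  relators : seq (word 'I_ngens);
  pres_map : presented [set` relators]%classic -> G;
  pres_map_iso : isomorphism pres_map }.

Local Open Scope nat_scope.

Lemma nat_infimumP (A : set nat) : (A !=set0)%classic ->
  A (infimum 0 A) /\ forall n, A n -> infimum 0 A <= n.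
Proof.
move=> [a Aa]; have exA : exists n, `[< A n >] by exists a; apply/asboolP.
case: (ex_minnP exA) => m /asboolP Am minm.
have mm : infimums A m.
  by split=> [x Ax|x lx]; [exact/minm/asboolP | exact: lx].
have -> : infimum 0 A = m.
  rewrite /infimum; case: ifPn => [/eqP A0|_]; first by rewrite A0 in Am.
  case: xgetP => [x _ ix|/(_ m)//]; exact: is_subset1_infimums ix mm.
by split=> // n An; apply: minm; apply/asboolP.
Qed.

Lemma nat_supremumP (A : set nat) (b : nat) : (A !=set0)%classic ->
  (forall n, A n -> n <= b) ->
  A (supremum 0 A) /\ forall n, A n -> n <= supremum 0 A.
Proof.
move=> [a Aa] leb; have exA : exists n, `[< A n >] by exists a; apply/asboolP.
have leb' n : `[< A n >] -> n <= b by move=> /asboolP; exact: leb.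
case: (ex_maxnP exA leb') => m /asboolP Am maxm.
have mm : supremums A m.
  by split=> [x Ax|x lx]; [exact/maxm/asboolP | exact: lx].
have -> : supremum 0 A = m.
  rewrite /supremum; case: ifPn => [/eqP A0|_]; first by rewrite A0 in Am.
  case: xgetP => [x _ ix|/(_ m)//]; exact: is_subset1_supremums ix mm.
by split=> // n An; apply: maxm; apply/asboolP.
Qed.

Section ConjugatorLength.
Variables (G : groupType) (P : fin_presentation G).

Definition weval (w : word 'I_(ngens P)) : G := @pres_map G P (word_class _ w).

Definition wlen (g : G) : nat :=
  infimum 0 [set n | exists2 w, weval w = g & size w = n]%classic.

Definition conjugators (u v : G) : set G := fun c => (c * u * c^-1)%g = v.

(* Only meaningful when u and v are conjugate; it is then a minimum. *)
Definition conj_len (u v : G) : nat :=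
  infimum 0 (wlen @` conjugators u v)%classic.

Definition conjugate (u v : G) : Prop := exists c, conjugators u v c.

Definition CL (n : nat) : nat :=
  supremum 0 [set m | exists u v, [/\ conjugate u v, wlen u + wlen v <= n
                                     & conj_len u v = m]]%classic.

Lemma weval_surj g : exists w, weval w = g.
Proof.
have [_ [f fK Kf]] := pres_map_iso P.
by exists (presented_repr (f g)); rewrite /weval presented_reprK Kf.
Qed.

Lemma wlenP g : (exists2 w, weval w = g & size w = wlen g)
  /\ forall w, weval w = g -> wlen g <= size w.
Proof.
have [|h1 h2] := @nat_infimumP [set n | exists2 w, weval w = g & size w = n]%classic.
  by have [w wg] := weval_surj g; exists (size w), w.
by split=> // w wg; apply: h2; exists w.
Qed.

Lemma conj_lenP u v : conjugate u v ->
  (exists2 c, (c * u * c^-1)%g = v & wlen c = conj_len u v)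
  /\ forall c, (c * u * c^-1)%g = v -> conj_len u v <= wlen c.
Proof.
move=> [c0 c0P]; have [|[c cP cE] h2] := @nat_infimumP (wlen @` conjugators u v)%classic.
  by exists (wlen c0), c0.
by split=> [|d dP]; [exists c | apply: h2; exists d].
Qed.

Lemma CLP n :
  (exists u v, [/\ conjugate u v, wlen u + wlen v <= n & conj_len u v = CL n])
  /\ forall u v, conjugate u v -> wlen u + wlen v <= n -> conj_len u v <= CL n.
Proof.
pose L := {bseq n of 'I_(ngens P) * bool}.
pose b := \max_(p : L * L) conj_len (weval p.1) (weval p.2).
have [|m [u [v [cuv le_n <-]]]|h1 h2] := @nat_supremumP [set m | exists u v,
  [/\ conjugate u v, wlen u + wlen v <= n & conj_len u v = m]]%classic b.
- have w1 : wlen (weval [::]) = 0.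
    by apply/eqP; rewrite -leqn0; exact: (proj2 (wlenP _) [::] erefl).
  exists (conj_len (weval [::]) (weval [::])), (weval [::]), (weval [::]).
  split; last by [].
    by exists 1%g; rewrite /conjugators mul1g invg1 mulg1.
  by rewrite w1.
- have [[w1 e1 s1] _] := wlenP u; have [[w2 e2 s2] _] := wlenP v.
  have l1 : size w1 <= n by rewrite s1; exact: leq_trans (leq_addr _ _) le_n.
  have l2 : size w2 <= n by rewrite s2; exact: leq_trans (leq_addl _ _) le_n.
  rewrite -e1 -e2.
  exact: (@leq_bigmax _ (fun p : L * L => conj_len (weval p.1) (weval p.2))
           (Bseq l1, Bseq l2)).
by split=> // u v cuv le_n; apply: h2; exists u, v.
Qed.

End ConjugatorLength.

Definition fun_preceq (f g : nat -> nat) : Prop :=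
  exists2 C : nat, (0 < C)%N &
    forall n, (f n <= C * g (C * n + C) + C * n + C)%N.

Definition fun_simeq (f g : nat -> nat) : Prop :=
  fun_preceq f g /\ fun_preceq g f.

(* Main.v *)
(** G acts affinely on Q, a vertex generator acting as a translation, so that
exponents are at most exponential in word length (linear if all moduli are 1),
while vertex groups are exponentially distorted as soon as some modulus is not 1.

Elliptic elements. By Britton's lemma, conjugacy of a_v^m and a_w^n is preserved
by multiplying m and n by an integer, and by dividing them by a common prime
factor that divides no edge label. By Dickson's lemma for divisibility, finitely
many conjugators therefore suffice to shrink an exponent that is not minimal in
its class by a constant factor, and finitely many to pass between two minimal
ones; the number of steps is logarithmic in the exponent, hence linear in the
length.

Hyperbolic elements. By Collins' lemma, conjugate cyclically reduced words are,
up to rotations, conjugate by a power a_v^z of a vertex generator. The affine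
action turns this into a linear equation in z; either it determines z, or z may
be reduced modulo a power that commutes with the word. *)

From HB Require Import structures.
From mathcomp Require Import all_boot all_order all_algebra.
From mathcomp Require Import boolp classical_sets.
From mathcomp Require Import zify ring lra.
Require Import Defs.

Set Implicit Arguments.
Unset Strict Implicit.
Unset Printing Implicit Defensive.
Import Order.TTheory GRing.Theory Num.Theory.

Local Open Scope group_scope.

(** * Permutation groups, presentations and forests *)

(** The exponents in a word for [g] can be exponentially large in the length of [g], so a vertex
    power must not be charged by its exponent. Words are weighed by [cost] instead, which charges
    each vertex power its length in the group. Removing a pinch replaces a vertex power by a
    conjugate under an edge letter, and the two edge letters that vanish pay for the change; so
    reduction never increases the cost.

    Britton's lemma is obtained from an action on normal forms. Tree letters are trivial in [pi1 T],
    yet every dart acts nontrivially on normal forms that forget vertices. A potential on the tree,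
    with values in the acting group, corrects this: conjugating the vertex groups by it makes the
    tree edges trivial. A potential with values in the homotheties of Q likewise fixes the
    translation lengths of the affine action. *)

Record perm_of (X : Type) := PermOf {
  pfun : X -> X;
  pinv : X -> X;
  pfunK : cancel pfun pinv;
  pinvK : cancel pinv pfun }.

Section PermGroup.
Variable X : Type.
Implicit Types f g : perm_of X.

Lemma perm_ofP f g : pfun f =1 pfun g -> f = g.
Proof.
case: f g => [f f' fK f'K] [g g' gK g'K] /= fg.
have efg : f = g by apply/funext.
have ef'g' : f' = g' by apply/funext => x; rewrite -{1}(g'K x) -fg fK.
subst g g'; congr PermOf; exact: Prop_irrelevance.
Qed.

HB.instance Definition _ := gen_eqMixin (perm_of X).
HB.instance Definition _ := gen_choiceMixin (perm_of X).

Definition perm_one := @PermOf X id id (frefl id) (frefl id).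
Definition perm_mul f g :=
  PermOf (can_comp (pfunK f) (pfunK g)) (can_comp (pinvK g) (pinvK f)).
Definition perm_inv f := PermOf (pinvK f) (pfunK f).

Lemma perm_mulA : associative perm_mul.
Proof. by move=> f g h; apply: perm_ofP. Qed.
Lemma perm_mul1 : left_id perm_one perm_mul.
Proof. by move=> f; apply: perm_ofP. Qed.
Lemma perm_mulr1 : right_id perm_one perm_mul.
Proof. by move=> f; apply: perm_ofP. Qed.
Lemma perm_mulV : left_inverse perm_one perm_inv perm_mul.
Proof. by move=> f; apply: perm_ofP => x /=; rewrite pfunK. Qed.
Lemma perm_mulrV : right_inverse perm_one perm_inv perm_mul.
Proof. by move=> f; apply: perm_ofP => x /=; rewrite pinvK. Qed.

HB.instance Definition _ := isGroup.Build (perm_of X) perm_mulA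
  perm_mul1 perm_mulr1 perm_mulV perm_mulrV.

Lemma permM f g x : pfun (f * g) x = pfun f (pfun g x). Proof. by []. Qed.
Lemma perm1 x : pfun (1 : perm_of X) x = x. Proof. by []. Qed.

End PermGroup.

Section Universal.
Variables (X : choiceType) (R : set (word X)) (H : groupType) (phi : X -> H).

Definition letter_val (l : X * bool) : H := if l.2 then (phi l.1)^-1 else phi l.1.
Definition word_val (w : word X) : H := foldr (fun l x => letter_val l * x) 1 w.

Lemma word_val_cat w1 w2 : word_val (w1 ++ w2) = word_val w1 * word_val w2.
Proof. by elim: w1 => [|l w1 IH] /=; rewrite ?mul1g // IH mulgA. Qed.

Lemma word_val_winv w : word_val (winv w) = (word_val w)^-1.
Proof.
elim: w => [|[x b] w IH] /=; first by rewrite invg1.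
rewrite /winv rev_cons map_rcons -cats1 word_val_cat /= mulg1 -/(winv w) IH invgM.
by congr (_ * _); rewrite /letter_val /=; case: b => //=; rewrite invgK.
Qed.

Hypothesis relH : forall r, R r -> word_val r = 1.

Lemma pres_eq_word_val w1 w2 : pres_eq R w1 w2 -> word_val w1 = word_val w2.
Proof.
elim=> {w1 w2} [//|w1 w2 _ -> //|w1 w2 w3 _ -> _ -> //| | |r /relH ->//].
  by move=> w1 w2 w1' w2' _ e1 _ e2; rewrite !word_val_cat e1 e2.
by move=> x b; rewrite /= /letter_val /=; case: b; rewrite /= mulg1 ?mulgV ?mulVg.
Qed.

Definition presented_hom (a : presented R) : H := word_val (presented_repr a).

Lemma presented_homE w : presented_hom (word_class R w) = word_val w.
Proof. by apply/pres_eq_word_val/word_classP; exact: presented_reprK. Qed.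

Lemma presented_homM : {morph presented_hom : a b / a * b}.
Proof.
move=> a b; rewrite -(presented_reprK a) -(presented_reprK b).
by rewrite [_ * _]presented_mulE !presented_homE word_val_cat.
Qed.

End Universal.

Section Forest.
Variable Gam : graph_of_groups.
Implicit Type T : {set edge Gam}.

Lemma adj_dart T (d : dart Gam) : d.1 \in T -> adj T (dsrc d) (dtgt d).
Proof. by move=> dT; apply/existsP; exists d; rewrite dT !eqxx. Qed.

Lemma adj_sym T : symmetric (adj T).
Proof.
suff S u v : adj T u v -> adj T v u by move=> u v; apply/idP/idP; exact: S.
case/existsP => d /and3P[dT /eqP <- /eqP <-].
by apply/existsP; exists (drev d); rewrite dT /dsrc /dtgt /=; case: d.2; rewrite !eqxx.
Qed.

(** The dart [d0] by which [x] was entered makes the induction exclude backtracking: undoing [d0]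
    would use an edge of [T] and lead back to [dsrc d0]. *)
Lemma path_darts T x p : path (adj T) x p -> uniq (x :: p) ->
  exists c : seq (dart Gam), [/\ map (@dtgt Gam) c = p,
    {in c, forall d, d.1 \in T} & forall d0, dtgt d0 = x ->
      (d0.1 \notin T) || (dsrc d0 \notin p) ->
      path [rel d d' | (dtgt d == dsrc d') && (d' != drev d)] d0 c].
Proof.
elim: p x => [|y p IH] x; first by exists [::].
move=> /= /andP[/existsP[d /and3P[dT /eqP dx /eqP dy]] yp] /andP[xyp uyp].
have [c [cp cT cP]] := IH _ yp uyp.
exists (d :: c); split=> [|d'|d0 d0x d0P]; first by rewrite /= dy cp.
  by rewrite inE => /predU1P[->//|/cT].
rewrite /= d0x dx eqxx /= cP ?andbT //; last first.
  by move: xyp; rewrite dx inE => /norP[_ ->]; rewrite orbT.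
apply: contraTneq d0P => dE; rewrite negb_or !negbK.
have -> : d0 = drev d by rewrite dE /drev /= negbK; case: (d0).
rewrite /= dT /=; suff -> : dsrc (drev d) = y by rewrite mem_head.
by rewrite -dy /dsrc /dtgt /=; case: (d.2).
Qed.

(** A simple path from [tgt e] to [src e] that avoids [e] would be closed by [e] to a circuit. *)
Lemma no_circuit_disconnected T e :
  (forall c, circuit c -> ~ {in c, forall d : dart Gam, d.1 \in T}) ->
  e \in T -> ~~ connect (adj (T :\ e)) (tgt e) (src e).
Proof.
move=> noc eT; apply/negP => /connectP[p0 p0P p0E].
case: (shortenP p0P) p0E => p pP up _ pE {p0 p0P}.
have [c [cp cT cP]] := path_darts pP up.
pose d : dart Gam := (e, false).
have {}cP : path [rel d d' | (dtgt d == dsrc d') && (d' != drev d)] d c.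
  by apply: cP => //; rewrite !inE eqxx.
apply: (noc (d :: c)); last first.
  by move=> d'; rewrite inE => /predU1P[->//|/cT]; rewrite inE => /andP[].
apply/and3P; split=> //; last by rewrite /= cp.
rewrite /= rcons_path cP /=.
have -> : dtgt (last d c) = src e by rewrite pE -cp -[tgt e]/(dtgt d) last_map.
rewrite eqxx /=.
case: c cT {cp cP} => [|d1 c] cT; first by apply/eqP; case.
have /cT : last d1 c \in d1 :: c by rewrite mem_last.
apply: contraTneq => dE; rewrite !inE negb_and negbK.
by have /= -> := congr1 fst dE; rewrite eqxx.
Qed.

(** Remove an edge [e], solve for the rest, and multiply the potential on the side of [tgt e] by the
    constant [h] that makes the equation hold at [e]; the other equations survive because the factor
    is on the left and no other edge joins the two sides. The subgroup [K] allows the values to be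
    confined, for instance to homotheties. *)
Lemma forest_potential T (H : groupType) (f : edge Gam -> H) (K : H -> Prop) :
  (forall c, circuit c -> ~ {in c, forall d : dart Gam, d.1 \in T}) ->
  K 1 -> (forall x y, K x -> K y -> K (x * y)) -> (forall x, K x -> K x^-1) ->
  (forall e, K (f e)) ->
  exists2 g : vert Gam -> H, (forall v, K (g v)) &
    {in T, forall e, g (src e) * f e = g (tgt e)}.
Proof.
move=> noc K1 KM KV Kf; have [n] := ubnP #|T|; elim: n => // n IH in T noc *.
rewrite ltnS => leT; case: (set_0Vmem T) => [->|[e eT]].
  by exists (fun=> 1) => // e; rewrite inE.
have noc' c : circuit c -> ~ {in c, forall d : dart Gam, d.1 \in T :\ e}.
  by move=> /noc cT cT'; apply: cT => d /cT'; rewrite inE => /andP[].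
have [|g Kg gE] := IH _ noc'; first by rewrite [#|T|](cardsD1 e) eT in leT.
pose comp v := connect (adj (T :\ e)) (tgt e) v.
have comp_src := no_circuit_disconnected noc eT.
pose h := g (src e) * f e * (g (tgt e))^-1.
exists (fun v => if comp v then h * g v else g v) => [v|e' e'T].
  by case: ifP => _ //; exact: KM (KM _ _ (KM _ _ (Kg _) (Kf _)) (KV _ (Kg _))) (Kg _).
case: (eqVneq e' e) => [->|ne].
  by rewrite /comp (negbTE comp_src) connect0 /h mulgVK.
have e'T' : e' \in T :\ e by rewrite !inE ne.
have -> : comp (src e') = comp (tgt e').
  have a1 : adj (T :\ e) (src e') (tgt e') by exact: (@adj_dart _ (e', false)).
  have a2 : adj (T :\ e) (tgt e') (src e') by rewrite adj_sym.
  by apply/idP/idP => /connect_trans; apply; exact: connect1.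
by case: ifP => _; rewrite -?mulgA gE.
Qed.

End Forest.

(** * Divisibility and geometric descent in the natural numbers *)

Local Open Scope nat_scope.

(* Dickson's lemma for the divisibility order on S-smooth integers: the second
   hypothesis lets all primes outside S be cancelled. *)
Lemma dvdn_finite_basis (S : seq nat) (Q : nat -> Prop) :
  (forall k n, 0 < k -> 0 < n -> Q n -> Q (k * n)) ->
  (forall p n, prime p -> p \notin S -> 0 < n -> Q (p * n) -> Q n) ->
  exists B, forall n, 0 < n -> Q n -> exists d, [/\ 0 < d, d <= B, d %| n & Q d].
Proof.
elim: S Q => [|q S IH] Q QM Qp.
  exists 1 => n n0 Qn; exists 1; split=> //.
  elim/ltn_ind: n => n IHn in n0 Qn *; have [n1|n1] := leqP n 1.
    by have <- : n = 1 by lia.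
  have pp : prime (pdiv n) by rewrite pdiv_prime.
  have nE : n %/ pdiv n * pdiv n = n by rewrite divnK ?pdiv_dvd.
  have d0 : 0 < n %/ pdiv n by rewrite divn_gt0 ?pdiv_gt0 // dvdn_leq ?pdiv_dvd.
  apply: (IHn (n %/ pdiv n)) => //; first by rewrite ltn_Pdiv ?prime_gt1.
  by apply: (Qp (pdiv n)) => //; rewrite mulnC nE.
have [pq|npq] := boolP (prime q); last first.
  apply: IH => // p n pp pS; apply: Qp => //; rewrite inE negb_or pS andbT.
  by apply: contraNneq npq => <-.
have q0 := prime_gt0 pq.
have q'1 : q`_q^' = 1 by apply: part_p'nat; rewrite pnatNK; exact: pnat_id.
have q'p p : prime p -> p != q -> p`_q^' = p.
  by move=> pp npq; apply: part_pnat_id; rewrite pnatE // !inE.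
(* The exponent of [q] is treated apart. [Qi] fixes it at [i], and taking the part of [n] prime to
   [q] makes [q] cancellable, so that the induction hypothesis applies; [Qoo] below allows any
   exponent. From the exponent [I] on, all the bounded divisors for [Qoo] are realized, and the
   finitely many smaller exponents use their own bounds [b i]. *)
pose Qi i n := Q (q ^ i * n`_q^').
have /choice[b bP] i : exists B, forall n, 0 < n -> Qi i n ->
    exists d, [/\ 0 < d, d <= B, d %| n & Qi i d].
  apply: IH => [k n k0 n0|p n pp pS n0]; rewrite /Qi partnM ?(prime_gt0 pp) //.
    by rewrite mulnCA; apply: QM; rewrite ?muln_gt0 ?expn_gt0 ?q0 ?part_gt0.
  have [->|npq] := eqVneq p q; first by rewrite q'1 mul1n.
  rewrite q'p // mulnCA; apply: Qp => //; first by rewrite inE negb_or npq.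
  by rewrite muln_gt0 expn_gt0 q0 part_gt0.
pose Qoo n := exists i, Q (q ^ i * n).
have [Boo BooP] : exists B, forall n, 0 < n -> Qoo n ->
    exists d, [/\ 0 < d, d <= B, d %| n & Qoo d].
  apply: IH => [k n k0 n0 [i Qin]|p n pp pS n0 [i Qin]].
    by exists i; rewrite mulnCA; apply: QM; rewrite ?muln_gt0 ?expn_gt0 ?q0.
  have [pE|npq] := eqVneq p q.
    by exists i.+1; rewrite expnSr -mulnA -{2}pE.
  exists i; apply: (Qp p) => //; rewrite ?inE ?negb_or ?npq //.
    by rewrite muln_gt0 expn_gt0 q0.
  by rewrite mulnCA.
have /choice[ex exP] (d : nat) : exists i, Qoo d -> Q (q ^ i * d).
  by have [[i Qi']|nQ] := pselect (Qoo d); [exists i | exists 0].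
pose I := \max_(d < Boo.+1) ex d.
exists (q ^ I * Boo + \max_(i < I) (q ^ i * b i)) => n n0 Qn.
have nE : n = q ^ logn q n * n`_q^' by rewrite -p_part partnC.
have n'0 : 0 < n`_q^' := part_gt0 _ _.
have [leI|ltI] := leqP I (logn q n).
  have [|d [d0 dB dn Qd]] := BooP _ n'0; first by exists (logn q n); rewrite -nE.
  exists (q ^ I * d); split.
  - by rewrite muln_gt0 expn_gt0 q0.
  - by apply: leq_trans (leq_addr _ _); rewrite leq_mul2l dB orbT.
  - by rewrite nE dvdn_mul // dvdn_exp2l.
  have leE : ex d <= I.
    exact: (@leq_bigmax _ (fun d : 'I_Boo.+1 => ex d) (Ordinal (dB : d < Boo.+1))).
  rewrite -(subnK leE) expnD -mulnA; apply: QM (exP _ Qd); first by rewrite expn_gt0 q0.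
  by rewrite muln_gt0 expn_gt0 q0.
have [|d [d0 dB dn Qd]] := bP (logn q n) n`_q^' n'0.
  by rewrite /Qi (@part_pnat_id _ n`_q^') ?part_pnat // -nE.
exists (q ^ logn q n * d`_q^'); split=> //.
- by rewrite muln_gt0 expn_gt0 q0 part_gt0.
- apply: leq_trans (leq_addl _ _).
  apply: leq_trans (@leq_bigmax _ (fun i : 'I_I => q ^ i * b i) (Ordinal ltI)) => /=.
  rewrite leq_mul2l; apply/orP; right; apply: leq_trans dB.
  by apply: dvdn_leq => //; exact: dvdn_part.
rewrite [X in _ %| X]nE dvdn_mul //; apply: dvdn_trans dn; exact: dvdn_part.
Qed.

(** A form of Bernoulli's inequality, [D * B ^ D <= B * B.+1 ^ D], taken at [D = K * B + 1]. *)
Lemma expn_ratio B K : exists D, K * B ^ D <= B.+1 ^ D.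
Proof.
have H D : D * B ^ D <= B * B.+1 ^ D.
  elim: D => [|D IH]; first by [].
  have le : B ^ D <= B.+1 ^ D by case: D {IH} => // D; rewrite leq_exp2r.
  by rewrite !expnS; nia.
exists (K * B).+1; have [->|B0] := posnP B; first by rewrite exp0n // muln0.
have := H (K * B).+1; move=> le; rewrite -(leq_pmul2l B0).
apply: leq_trans le; rewrite mulnA leq_mul2r; lia.
Qed.

(** [Q k s] is to be read as: [s] can be treated at cost [k]. A step costs [C] and shrinks the size
    by the factor [B / B.+1], so a size of at most [K ^ n] is exhausted in a number of steps linear
    in [n]; the alternative [Q C s] stops the descent early. *)
Lemma descent (S : Type) (sz : S -> nat) (Q : nat -> S -> Prop) B C K : 0 < K ->
  (forall s, sz s = 0 -> Q C s) ->
  (forall s, Q C s \/ exists s', B.+1 * sz s' <= B * sz s /\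
     forall n, Q n s' -> Q (C + n) s) ->
  exists D, forall n s, sz s <= K ^ n -> exists2 k, k <= D * n.+1 & Q k s.
Proof.
move=> K0 Q0 QS.
have H j s : sz s * B ^ j < B.+1 ^ j -> exists2 k, k <= C * j.+1 & Q k s.
  elim: j s => [|j IH] s.
    by rewrite !expn0 muln1 ltnS leqn0 => /eqP s0; exists C; [rewrite muln1|exact: Q0].
  have [Qs _|[s' [les' Qs']] lts] := QS s; first by exists C => //; rewrite leq_pmulr.
  have [|k lek /Qs' Qk] := IH s'; last by exists (C + k) => //; rewrite mulnS leq_add2l.
  rewrite -(ltn_pmul2l (ltn0Sn B)) -expnS; apply: leq_ltn_trans lts.
  by rewrite mulnA expnS mulnA leq_mul2r [sz s * _]mulnC les' orbT.
have [D DP] := expn_ratio B K.+1.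
exists (C * D.+1) => n s les.
have [|k lek Qk] := H (D * n.+1) s.
  have le1 : K.+1 ^ n.+1 * B ^ (D * n.+1) <= B.+1 ^ (D * n.+1).
    by rewrite !expnM -expnMn leq_exp2r.
  have [B0|B0] := posnP B.
    have D0 : 0 < D by move: DP; clear -K0; case: D => //; rewrite !expn0; lia.
    by rewrite B0 exp0n ?muln0 ?muln_gt0 ?D0 // expn_gt0.
  apply: leq_trans le1.
  rewrite ltn_mul2r expn_gt0 B0 /=; apply: leq_ltn_trans les _.
  apply: (@leq_ltn_trans (K.+1 ^ n)); last by rewrite ltn_exp2l.
  by case: (n) => // m; rewrite leq_exp2r.
exists k => //; apply: leq_trans lek _; nia.
Qed.

Local Open Scope ring_scope.

(** * Normal forms *)

Lemma dvdz_mod (d m : int) : (d %| (m %% d)%Z)%Z = (d %| m)%Z.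
Proof. by apply/dvdz_mod0P/dvdz_mod0P; rewrite modz_mod. Qed.

Section NormalForms.
Variables (Gam : graph_of_groups) (p q : edge Gam -> int).
Hypotheses (p0 : forall e, p e != 0) (q0 : forall e, q e != 0).
Implicit Type d : dart Gam.

(** Up to sign, the index of the edge group in the vertex group at [dsrc d]; the one at [dtgt d] is
    [lab (drev d)]. *)
Definition lab d : int := if d.2 then q d.1 else p d.1.

Lemma lab_neq0 d : lab d != 0. Proof. by rewrite /lab; case: d.2. Qed.

Lemma drevK : involutive (@drev Gam).
Proof. by case=> e b; rewrite /drev /= negbK. Qed.

Lemma dsrc_drev d : dsrc (drev d) = dtgt d.
Proof. by rewrite /dsrc /dtgt /=; case: d.2. Qed.

Lemma dtgt_drev d : dtgt (drev d) = dsrc d.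
Proof. by rewrite /dsrc /dtgt /=; case: d.2. Qed.

(* NFcons r d x is the class of a^r d x, with r the representative of its coset
   modulo lab d; vertices are forgotten, so that all normal forms make one set. *)
Inductive nform := NFend of int | NFcons of int & dart Gam & nform.

Definition backtracks d x : bool :=
  if x is NFcons r d' _ then (d' == drev d) && (lab d' %| r)%Z else false.

Fixpoint valid x : bool :=
  if x is NFcons r d y then [&& (r %% lab d)%Z == r, ~~ backtracks d y & valid y]
  else true.

(** The quotient of [m + r] by [lab d] crosses [d] by the edge relation, and the remainder stays as
    coset representative. *)
Fixpoint vact (m : int) x : nform :=
  match x with
  | NFend f => NFend (m + f)
  | NFcons r d y =>
    NFcons ((m + r) %% lab d)%Z d (vact (lab (drev d) * ((m + r) %/ lab d)%Z) y)
  end.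

(** In a valid form the exponent before a backtracking dart is a residue divisible by its label,
    hence 0; dropping it with the dart loses nothing. *)
Definition dact d x : nform :=
  if x is NFcons r d' y then if backtracks d x then y else NFcons 0 d x
  else NFcons 0 d x.

Lemma vact0 x : valid x -> vact 0 x = x.
Proof.
elim: x => [f _|r d y IH] /=; rewrite add0r // => /and3P[/eqP rE _ /IH yE].
have -> : (r %/ lab d)%Z = 0.
  have := divz_eq r (lab d); rewrite rE => /(canLR (addrK _)) /esym/eqP.
  by rewrite subrr mulf_eq0 (negbTE (lab_neq0 d)) orbF => /eqP.
by rewrite mulr0 yE rE.
Qed.

Lemma vactD m n x : vact (m + n) x = vact m (vact n x).
Proof.
elim: x m n => [f|r d y IH] m n /=; first by rewrite addrA.
rewrite -addrA modzDmr -IH -mulrDr; congr (NFcons _ _ (vact (_ * _) _)).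
rewrite {1}(divz_eq (n + r) (lab d)) addrCA divzMDl ?lab_neq0 //.
exact: addrC.
Qed.

Lemma backtracks_vact d k x :
  backtracks d (vact (lab (drev d) * k) x) = backtracks d x.
Proof.
case: x => //= r d' y; case: (eqVneq d' (drev d)) => [->|_] //=.
by rewrite dvdz_mod rpredDl // dvdz_mulr.
Qed.

Lemma valid_vact m x : valid x -> valid (vact m x).
Proof.
elim: x m => //= r d y IH m /and3P[_ bt vy].
by rewrite modz_mod eqxx backtracks_vact bt IH.
Qed.

Lemma valid_dact d x : valid x -> valid (dact d x).
Proof.
case: x => [f|r d' y]; first by rewrite /= mod0z eqxx.
rewrite /dact; case: ifPn => [_ /and3P[]//|bt v].
by rewrite /= mod0z eqxx /= bt; exact: v.
Qed.

Lemma valid_backtracks d x : valid x -> backtracks d x ->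
  exists y, [/\ x = NFcons 0 (drev d) y, valid y & ~~ backtracks (drev d) y].
Proof.
case: x => //= r d' y /and3P[/eqP rE bt vy] /andP[/eqP d'E dv].
exists y; rewrite -d'E; split=> //; congr NFcons.
by rewrite -rE; apply/dvdz_mod0P.
Qed.

Lemma dact_nbt d x : ~~ backtracks d x -> dact d x = NFcons 0 d x.
Proof. by rewrite /dact; case: x => // r d' y /negbTE ->. Qed.

Lemma dact_cancel d x : dact d (NFcons 0 (drev d) x) = x.
Proof. by rewrite /dact /= eqxx dvdz0. Qed.

Lemma dactK d x : valid x -> dact (drev d) (dact d x) = x.
Proof.
move=> vx; have [bt|nbt] := boolP (backtracks d x).
  have [y [-> vy nbt]] := valid_backtracks vx bt.
  by rewrite dact_cancel (dact_nbt nbt).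
by rewrite (dact_nbt nbt); have := dact_cancel (drev d) x; rewrite drevK.
Qed.

Lemma dact_vact d k x : valid x ->
  dact d (vact (lab (drev d) * k) x) = vact (lab d * k) (dact d x).
Proof.
move=> vx; have [bt|nbt] := boolP (backtracks d x).
  have [y [-> vy nbt]] := valid_backtracks vx bt.
  by rewrite [vact _ _]/= addr0 modzMr drevK mulKz ?lab_neq0 // !dact_cancel.
rewrite dact_nbt ?backtracks_vact // dact_nbt //= addr0.
by rewrite modzMr mulKz ?lab_neq0.
Qed.

Definition nf := {x | valid x}.

Lemma nf_inj (x y : nf) : sval x = sval y -> x = y.
Proof. exact: val_inj. Qed.

Definition nf_vact m (x : nf) : nf := exist (fun x => valid x) _ (valid_vact m (proj2_sig x)).
Definition nf_dact d (x : nf) : nf := exist (fun x => valid x) _ (valid_dact d (proj2_sig x)).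

Lemma nf_vactK m : cancel (nf_vact m) (nf_vact (- m)).
Proof. by move=> [x vx]; apply: nf_inj; rewrite /= -vactD addNr vact0. Qed.
Lemma nf_vactKV m : cancel (nf_vact (- m)) (nf_vact m).
Proof. by move=> [x vx]; apply: nf_inj; rewrite /= -vactD subrr vact0. Qed.
Lemma nf_dactK d : cancel (nf_dact d) (nf_dact (drev d)).
Proof. by move=> [x vx]; apply: nf_inj; rewrite /= dactK. Qed.
Lemma nf_dactKV d : cancel (nf_dact (drev d)) (nf_dact d).
Proof. by move=> x; rewrite -{1}(drevK d) nf_dactK. Qed.

Definition Vperm m : perm_of nf := PermOf (nf_vactK m) (nf_vactKV m).
Definition Dperm (e : edge Gam) : perm_of nf :=
  PermOf (nf_dactK (e, false)) (nf_dactKV (e, false)).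

Lemma VpermD m n : Vperm (m + n) = (Vperm m * Vperm n)%g.
Proof. by apply: perm_ofP => x; apply: nf_inj; rewrite /= vactD. Qed.

Lemma Dperm_rel e k :
  (Dperm e * Vperm (q e * k) = Vperm (p e * k) * Dperm e)%g.
Proof.
apply: perm_ofP => x; apply: nf_inj; rewrite permM /=.
by rewrite (@dact_vact (e, false)) // (proj2_sig x).
Qed.

End NormalForms.

(** * Words along paths of the graph, and equality of reduced words *)

Section Words.
Variable Gam : graph_of_groups.
Implicit Types (w : seq (int * dart Gam)) (x y : vert Gam).

(** A letter [(m, d)] stands for [a^m d], with [a] the generator at [dsrc d]. The power after the
    last dart is always kept apart from the word. *)
Fixpoint pathw x w y : bool :=
  if w is l :: w' then (dsrc l.2 == x) && pathw (dtgt l.2) w' y else x == y.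

Lemma pathw_cat x w1 y w2 z : pathw x w1 y -> pathw y w2 z -> pathw x (w1 ++ w2) z.
Proof.
elim: w1 x => [|l w1 IH] x /=; first by move/eqP->.
by case/andP => -> /IH h /h ->.
Qed.

Lemma pathw_catP x w1 w2 z : pathw x (w1 ++ w2) z -> exists2 y, pathw x w1 y & pathw y w2 z.
Proof.
elim: w1 x => [|l w1 IH] x /=; first by exists x.
by case/andP => -> /IH[y h1 h2]; exists y.
Qed.

Section Values.
Local Open Scope group_scope.
Variables (H : groupType) (A : vert Gam -> int -> H) (t : edge Gam -> H).

Definition tval (d : dart Gam) : H := if d.2 then (t d.1)^-1 else t d.1.

Lemma tval_drev d : tval (drev d) = (tval d)^-1.
Proof. by rewrite /tval /=; case: d.2; rewrite //= invgK. Qed.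

Fixpoint wval w : H :=
  if w is l :: w' then A (dsrc l.2) l.1 * tval l.2 * wval w' else 1.

Lemma wval_cons l w : wval (l :: w) = A (dsrc l.2) l.1 * tval l.2 * wval w.
Proof. by []. Qed.

Lemma wval_cat w1 w2 : wval (w1 ++ w2) = wval w1 * wval w2.
Proof. by elim: w1 => [|l w1 IH]; rewrite ?mul1g //= IH mulgA. Qed.

End Values.

(* a^j * (w, f), where (w, f) stands for wval w * a^f. *)
Definition addl (j : int) (w : seq (int * dart Gam)) (f : int) :=
  if w is l :: w' then ((j + l.1, l.2) :: w', f) else ([::], j + f).

End Words.

Section Carry.
Variables (Gam : graph_of_groups) (p q : edge Gam -> int).
Hypotheses (p0 : forall e, p e != 0) (q0 : forall e, q e != 0).
Implicit Types (w : seq (int * dart Gam)).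
Local Notation lab := (lab p q).

(* Fails when the subword d a^m d' (letters l = (_, d) and l' = (m, d')) is
   equal to an element of the vertex group at the source of d. *)
Definition nopinch : rel (int * dart Gam) :=
  fun l l' => ~~ ((l'.2 == drev l.2) && (lab l'.2 %| l'.1)%Z).

Fixpoint nfw w f : nform Gam :=
  if w is l :: w' then vact p q l.1 (dact p q l.2 (nfw w' f)) else NFend _ f.

(** No dart of a reduced word cancels, so the normal form has the same darts and its head can be
    read off the first letter. *)
Lemma nfw_cons l w f : sorted nopinch (l :: w) ->
  nfw (l :: w) f = NFcons (l.1 %% lab l.2)%Z l.2
     (vact p q (lab (drev l.2) * (l.1 %/ lab l.2)%Z) (nfw w f)).
Proof.
elim: w l => [|l' w IH] l; first by rewrite /= addr0.
case/andP => nb /IH e.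
have nb' : ~~ backtracks p q l.2 (nfw (l' :: w) f) by rewrite e /= dvdz_mod.
rewrite -[LHS]/(vact p q l.1 (dact p q l.2 (nfw (l' :: w) f))) (dact_nbt nb').
by rewrite [LHS]/= addr0.
Qed.

(* The relation a^j * (w1, f1) = (w2, f2) between reduced words: j is pushed
   through the darts, becoming lab (drev d) * k after d when it is lab d * k. *)
Fixpoint carry (j : int) w1 f1 w2 f2 : Prop :=
  match w1, w2 with
  | [::], [::] => j + f1 = f2
  | l1 :: w1', l2 :: w2' => l1.2 = l2.2 /\ exists k,
      j + l1.1 = l2.1 + lab l1.2 * k /\ carry (lab (drev l1.2) * k) w1' f1 w2' f2
  | _, _ => False
  end.

Lemma valid_nfw w f : valid p q (nfw w f).
Proof. by elim: w => //= l w IH; apply/valid_vact/valid_dact. Qed.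

Lemma nfw_carry j w1 f1 w2 f2 : sorted nopinch w1 -> sorted nopinch w2 ->
  vact p q j (nfw w1 f1) = nfw w2 f2 -> carry j w1 f1 w2 f2.
Proof.
elim: w1 w2 j => [|l1 w1 IH] [|l2 w2] j s1 s2.
- by case.
- by rewrite nfw_cons.
- by rewrite nfw_cons.
rewrite !nfw_cons //= => -[em e12 ev]; split=> //; move: em ev; rewrite -e12.
set l := lab _; set l' := lab _ => em ev.
(* The quotient produced by [j], corrected by the quotients that the two leading exponents have
   already sent across the dart. *)
exists (((j + (l1.1 %% l)%Z) %/ l)%Z + (l1.1 %/ l)%Z - (l2.1 %/ l)%Z); split.
  rewrite {1}(divz_eq l1.1 l) {1}(divz_eq l2.1 l) -em.
  have := divz_eq (j + (l1.1 %% l)%Z) l.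
  set a := ((_ + _) %/ l)%Z; set b := ((_ + _) %% l)%Z => h.
  rewrite addrCA h; ring.
apply: IH; [exact: path_sorted s1|exact: path_sorted s2|].
rewrite mulrDr addrC vactD // mulrDr vactD // ev -vactD // mulrN addNr vact0 //.
exact: valid_nfw.
Qed.

(** Divisibility by [r] travels backwards along the word: at each dart [r] divides
    [lab (drev d) * k] but not the label, hence it divides [k] and the power before the dart. *)
Lemma carry_divide r j c f m : prime r -> (forall e, ~~ (r %| p e)%Z) ->
  (forall e, ~~ (r %| q e)%Z) -> carry j c f c (f + r%:Z * m) ->
  exists2 j', j = r%:Z * j' & carry j' c f c (f + m).
Proof.
move=> pr rp rq; have rl d : ~~ (r %| lab d)%Z by rewrite /lab; case: d.2.
elim: c j => [|l c IH] j /=; first by rewrite addrC => /addrI ->; exists m; rewrite // addrC.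
case=> _ [k [jE /IH[k' kE ck']]].
have : (r %| lab (drev l.2) * k)%Z by rewrite kE dvdz_mulr.
rewrite dvdzE abszM Euclid_dvdM // => /orP[h|/dvdzP[k2 k2E]].
  by have := rl (drev l.2); rewrite dvdzE h.
have r0 : r%:Z != 0 by rewrite -lt0n prime_gt0.
have k'E : k' = lab (drev l.2) * k2.
  by apply: (mulfI r0); rewrite -kE k2E mulrCA mulrC; ring.
exists (lab l.2 * k2).
  by apply: (addIr l.1); rewrite jE k2E; ring.
by split=> //; exists k2; rewrite addrC -k'E.
Qed.

End Carry.

Section Interface.
Local Open Scope group_scope.
Variables (Gam : graph_of_groups) (T : {set edge Gam}) (p q : edge Gam -> int).

(* What is used of pi1 T: A v m is the m-th power of a generator of the group of
   v, and t e the stable letter of e. *)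
Record gbs_group (G : groupType) (A : vert Gam -> int -> G) (t : edge Gam -> G) : Prop := {
  gbs_p0 : forall e, p e != 0%R;
  gbs_q0 : forall e, q e != 0%R;
  gbs_AD : forall v (m n : int), A v (m + n)%R = A v m * A v n;
  gbs_rel : forall e k, t e * A (tgt e) (q e * k)%R = A (src e) (p e * k)%R * t e;
  gbs_tree : forall e, e \in T -> t e = 1;
  gbs_ind : forall Q : G -> Prop, Q 1 -> (forall g h, Q g -> Q h -> Q (g * h)) ->
    (forall g, Q g -> Q g^-1) -> (forall v m, Q (A v m)) -> (forall e, Q (t e)) ->
    forall g, Q g;
  gbs_univ : forall (H : groupType) (a : vert Gam -> int -> H) (s : edge Gam -> H),
    (forall v (m n : int), a v (m + n)%R = a v m * a v n) ->
    (forall e k, s e * a (tgt e) (q e * k)%R = a (src e) (p e * k)%R * s e) ->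
    (forall e, e \in T -> s e = 1) ->
    exists h : G -> H, [/\ {morph h : x y / x * y}, forall v m, h (A v m) = a v m
                         & forall e, h (t e) = s e] }.

End Interface.

Local Open Scope group_scope.

(** * Actions of the fundamental group *)

Section GbsTheory.
Variables (Gam : graph_of_groups) (T : {set edge Gam}) (p q : edge Gam -> int).
Variables (G : groupType) (A : vert Gam -> int -> G) (t : edge Gam -> G).
Hypothesis gG : gbs_group T p q A t.
Local Notation lab := (lab p q).
Local Notation td := (tval t).
Local Notation wv := (wval A t).
Local Notation nopinch := (nopinch p q).
Implicit Types (w : seq (int * dart Gam)).

Let AD := gbs_AD gG.

Lemma A0 v : A v 0%R = 1.
Proof. by apply: (@mulgI _ (A v 0%R)); rewrite -AD addr0 mulg1. Qed.

Lemma AN v m : A v (- m)%R = (A v m)^-1.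
Proof. by apply: (@mulgI _ (A v m)); rewrite -AD subrr mulgV A0. Qed.

Lemma A_comm v m n : A v m * A v n = A v n * A v m.
Proof. by rewrite -!AD addrC. Qed.

Lemma dart_rel d k :
  td d * A (dtgt d) (lab (drev d) * k)%R = A (dsrc d) (lab d * k)%R * td d.
Proof.
case: d => e [] /=; rewrite /td /lab /dtgt /dsrc /=; last exact: gbs_rel gG e k.
apply: (@mulgI _ (t e)); rewrite mulVKg mulgA (gbs_rel gG).
by rewrite mulgK.
Qed.

Hypothesis noc : forall c : seq (dart Gam), circuit c ->
  ~ {in c, forall d, d.1 \in T}.

(* Collapsing all vertex groups to one, G acts on the normal forms, up to
   conjugation by potentials that make the tree edges act trivially. *)
Lemma normal_form_action :
  exists h : G -> perm_of (nf p q), exists g : vert Gam -> perm_of (nf p q),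
  [/\ {morph h : x y / x * y},
      forall v m, h (A v m) = g v * Vperm (gbs_p0 gG) (gbs_q0 gG) m * (g v)^-1
    & forall e, h (t e) = g (src e) * Dperm p q e * (g (tgt e))^-1].
Proof.
set V := Vperm _ _; set D := Dperm p q.
have [g _ gE] := @forest_potential _ T _ D (fun=> True) noc I
  (fun _ _ _ _ => I) (fun _ _ => I) (fun=> I).
have [|e k|e eT|h [hM hA ht]] := gbs_univ gG
  (a := fun v m => g v * V m * (g v)^-1)
  (s := fun e => g (src e) * D e * (g (tgt e))^-1).
- by move=> v m n; rewrite !mulgA mulgVK /V VpermD !mulgA.
- by rewrite !mulgA !mulgVK -(mulgA _ (D e)) /D /V Dperm_rel !mulgA.
- by rewrite gE // mulgV.
by exists h, g.
Qed.

(** Both sides are applied to the normal form [NFend 0]. The potentials telescope along a path, and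
    those left at the ends cancel because the two words share their endpoints. *)
Lemma word_carry j x y w1 f1 w2 f2 : pathw x w1 y -> pathw x w2 y ->
  sorted nopinch w1 -> sorted nopinch w2 ->
  A x j * (wv w1 * A y f1) = wv w2 * A y f2 -> carry p q j w1 f1 w2 f2.
Proof.
move=> p1 p2 s1 s2 e12; have [h [g [hM hA ht]]] := normal_form_action.
pose V := Vperm (gbs_p0 gG) (gbs_q0 gG); pose D := Dperm p q.
have h1 : h 1 = 1 by apply: (@mulgI _ (h 1)); rewrite -hM !mulg1.
have hV a : h a^-1 = (h a)^-1 by apply: (@mulgI _ (h a)); rewrite -hM !mulgV.
have htd d : h (td d) = g (dsrc d) * tval D d * (g (dtgt d))^-1.
  case: d => e []; rewrite /tval /dsrc /dtgt /= ?ht //.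
  by rewrite hV ht !invgM invgK mulgA.
have hw z w : pathw z w y -> h (wv w) = g z * wval (fun=> V) D w * (g y)^-1.
  elim: w z => [|l w IH] z /=; first by move/eqP->; rewrite mulg1 mulgV h1.
  case/andP => /eqP <- /IH e; rewrite !hM hA htd e !mulgA !mulgVK.
  by [].
have nfE w f z : sval (pfun (wval (fun=> V) D w * V f)
    (exist (fun a => valid p q a) (NFend _ 0%R) z)) = nfw p q w f.
  elim: w => [|l w IH]; first by rewrite mul1g /= addr0.
  rewrite -[RHS]/(vact p q l.1 (dact p q l.2 (nfw p q w f))) -IH wval_cons.
  by rewrite -!mulgA !permM; case: l => m [e []].
move: (congr1 h e12); rewrite !hM !hA (hw _ _ p1) (hw _ _ p2) !mulgA !mulgVK.
move/mulIg; rewrite -!mulgA => /mulgI /(congr1 (fun s => sval (pfun s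
  (exist (fun a => valid p q a) (NFend _ 0%R) isT)))).
rewrite permM /= !nfE => /nfw_carry; apply=> //; first exact: gbs_p0 gG.
exact: gbs_q0 gG.
Qed.

(* g acts on Q by x |-> lam g * x + cc g, with |lam| the modular homomorphism;
   generators of vertex groups act by translations. *)
Lemma affine_representation : exists (s : vert Gam -> rat) (lam cc : G -> rat),
  [/\ [/\ forall v, s v != 0%R, lam 1 = 1%R & forall g, lam g != 0%R],
      forall g h, lam (g * h) = (lam g * lam h)%R,
      forall g h, cc (g * h) = (cc g + lam g * cc h)%R,
      forall v m, lam (A v m) = 1%R & forall v m, cc (A v m) = (s v * m%:~R)%R].
Proof.
have affP a b : a != 0%R -> exists f : perm_of rat, forall x, pfun f x = (a * x + b)%R.
  move=> a0.
  have fK : cancel (fun x => a * x + b)%R (fun x => a^-1 * (x - b))%R.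
    by move=> x; rewrite addrK mulKf.
  have Kf : cancel (fun x => a^-1 * (x - b))%R (fun x => a * x + b)%R.
    by move=> x; rewrite mulVKf // subrK.
  by exists (PermOf fK Kf).
have pq0 e : ((p e)%:~R != 0 :> rat)%R /\ ((q e)%:~R != 0 :> rat)%R.
  by rewrite !intr_eq0 (gbs_p0 gG) (gbs_q0 gG).
(* A potential with steps [p e / q e] gives translation lengths [s] that agree along the tree:
   [s (src e) * p e = s (tgt e) * q e]. *)
have /choice[f fE] e : exists f : perm_of rat, forall x,
    pfun f x = ((p e)%:~R / (q e)%:~R * x)%R.
  have [p0 q0] := pq0 e; have [|f fE] := affP ((p e)%:~R / (q e)%:~R)%R 0%R.
    by rewrite mulf_neq0 ?invr_eq0.
  by exists f => x; rewrite fE addr0.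
pose K (f : perm_of rat) := exists2 a, a != 0%R & forall x, pfun f x = (a * x)%R.
have [||||g Kg gE] := @forest_potential _ T _ f K noc.
- by exists 1%R; rewrite ?oner_eq0 // => x; rewrite mul1r.
- move=> g h [a a0 ga] [b b0 hb]; exists (a * b)%R; first by rewrite mulf_neq0.
  by move=> x; rewrite permM hb ga mulrA.
- move=> g [a a0 ga]; exists a^-1%R; rewrite ?invr_eq0 // => x.
  by rewrite -[in RHS](pinvK g x) ga mulKf.
- move=> e; exists ((p e)%:~R / (q e)%:~R)%R => //.
  by have [? ?] := pq0 e; rewrite mulf_neq0 ?invr_eq0.
have {Kg}/choice[s sP] v : exists s, s != 0%R /\ forall x, pfun (g v) x = (s * x)%R.
  by have [a a0 aE] := Kg v; exists a.
have s0 v : s v != 0%R by have [] := sP v.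
have sE e : e \in T -> (s (src e) * (p e)%:~R = s (tgt e) * (q e)%:~R)%R.
  move=> /gE /(congr1 (fun f => pfun f 1%R)); rewrite permM fE.
  have [_ ->] := sP (src e); have [_ ->] := sP (tgt e); have [p0 q0] := pq0 e.
  by rewrite !mulr1 => <-; rewrite mulrA divfK.
have /choice[tr trE] v : exists tr : int -> perm_of rat,
    forall m x, pfun (tr m) x = (x + s v * m%:~R)%R.
  have /choice[tr trE] m : exists f : perm_of rat, forall x,
      pfun f x = (x + s v * m%:~R)%R.
    have [f' f'E] := affP 1%R (s v * m%:~R)%R (oner_neq0 _).
    by exists f' => x; rewrite f'E mul1r.
  by exists tr.
(* The edge relation forces this ratio on [t e]; by [sE] it is 1 on the tree. *)
pose l e := (s (src e) * (p e)%:~R / (s (tgt e) * (q e)%:~R))%R.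
have l0 e : l e != 0%R.
  by have [p0 q0] := pq0 e; rewrite !mulf_neq0 ?invr_eq0 ?mulf_neq0.
have /choice[sc scE] e : exists sc : perm_of rat, forall x, pfun sc x = (l e * x)%R.
  by have [f' f'E] := affP _ 0%R (l0 e); exists f' => x; rewrite f'E addr0.
have [v m n|e k|e eT|h [hM hA ht]] := gbs_univ gG (a := tr) (s := sc).
- apply: perm_ofP => x; rewrite permM !trE intrD; ring.
- apply: perm_ofP => x; rewrite !permM !trE !scE ?trE /l !intrM.
  have [p0 q0] := pq0 e; field; rewrite ?p0 ?q0 ?s0 //.
- apply: perm_ofP => x; rewrite scE /l sE // divff ?mul1r // mulf_neq0 //.
  by have [] := pq0 e.
have aff g' : exists2 a, a != 0%R & forall x,
    pfun (h g') x = (a * x + pfun (h g') 0%R)%R.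
  have h1 : h 1 = 1 by apply: (@mulgI _ (h 1)); rewrite -hM !mulg1.
  elim/(gbs_ind gG): g' => [|g1 g2 [a a0 aE] [b b0 bE]|g1 [a a0 aE]|v m|e].
  - by exists 1%R => // x; rewrite h1 !perm1 mul1r addr0.
  - exists (a * b)%R => [|x]; first by rewrite mulf_neq0.
    by rewrite hM !permM bE aE [in RHS]aE; ring.
  - exists a^-1%R => [|x]; first by rewrite invr_eq0.
    have hV x' : pfun (h g1) (pfun (h g1^-1) x') = x' by rewrite -permM -hM mulgV h1.
    have := aE (pfun (h g1^-1) x); have := aE (pfun (h g1^-1) 0%R); rewrite !hV.
    set u := pfun _ 0%R; set z := pfun _ x; set c := pfun _ 0%R => e1 e2.
    rewrite {1}e2 (_ : c = - (a * u))%R; first by field.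
    by apply/eqP; rewrite -addr_eq0 addrC -e1.
  - by exists 1%R => // x; rewrite hA !trE add0r mul1r.
  - by exists (l e) => // x; rewrite ht !scE mulr0 addr0.
pose lam g' := (pfun (h g') 1%R - pfun (h g') 0%R)%R; pose cc g' := pfun (h g') 0%R.
have hE g' x : pfun (h g') x = (lam g' * x + cc g')%R.
  have [a a0 aE] := aff g'; rewrite /lam (aE 1%R) /cc.
  by rewrite {1}aE; ring.
have h1 : h 1 = 1 by apply: (@mulgI _ (h 1)); rewrite -hM !mulg1.
have lamM g1 g2 : lam (g1 * g2) = (lam g1 * lam g2)%R.
  by rewrite {1}/lam hM !permM !hE; ring.
exists s, lam, cc; split=> //.
- split=> // [|g']; first by rewrite /lam h1 !perm1 subr0.
  by have [a a0 aE] := aff g'; rewrite /lam (aE 1%R) mulr1 addrK.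
- by move=> g1 g2; rewrite {1}/cc hM permM !hE; ring.
- by move=> v m; rewrite /lam hA !trE; ring.
- by move=> v m; rewrite /cc hA trE add0r.
Qed.

End GbsTheory.

(** * Growth of exponents *)

Ltac lia_lengths W :=
  repeat match goal with
    | H : is_true (leq _ _) |- _ => revert H
    | H : @eq nat _ _ |- _ => revert H end;
  repeat (let n := fresh "n" in move: (W _) => n); clear; lia.

Lemma seq_bound (I : eqType) (X : seq I) (P : nat -> I -> Prop) :
  (forall m n x, (m <= n)%N -> P m x -> P n x) ->
  (forall x, exists n, P n x) -> exists N, forall x, x \in X -> P N x.
Proof.
move=> mono ex; elim: X => [|x X [N NP]]; first by exists 0%N.
have [n nP] := ex x; exists (n + N)%N => y; rewrite inE => /predU1P[->|/NP].
  by apply: mono nP; exact: leq_addr.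
by apply: mono; exact: leq_addl.
Qed.

Lemma fin_bound (I : finType) (P : nat -> I -> Prop) :
  (forall m n x, (m <= n)%N -> P m x -> P n x) ->
  (forall x, exists n, P n x) -> exists N, forall x, P N x.
Proof.
move=> mono ex; have [N NP] := seq_bound (enum I) mono ex.
by exists N => x; apply: NP; rewrite mem_enum.
Qed.

Lemma rat_bound (r : rat) : exists n : nat, (r <= n%:R)%R.
Proof.
exists (Num.bound `|r|%R).
exact: le_trans (ler_norm r) (ltW (archi_boundP (normr_ge0 r))).
Qed.

Lemma absz_le_rat (m : int) (N : nat) : (`|m%:~R : rat| <= N%:R)%R -> (`|m| <= N)%N.
Proof. by rewrite -intr_norm -[N%:R]/(N%:~R) ler_int -abszE lez_nat. Qed.

(** [wm_ind] expresses that [g] is a product of exactly [W g] elements of [X]. *)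
Record word_metric (G : groupType) (W : G -> nat) (X : seq G) : Prop := {
  wm1 : W 1 = 0%N;
  wmM : forall g h : G, (W (g * h)%g <= W g + W h)%N;
  wmV : forall g : G, (W (g^-1)%g <= W g)%N;
  wm_ind : forall P : nat -> G -> Prop, P 0%N 1 ->
    (forall x n g, x \in X -> P n g -> P n.+1 (x * g)) -> forall g, P (W g) g }.

Section Quantitative.
Variables (Gam : graph_of_groups) (T : {set edge Gam}) (p q : edge Gam -> int).
Variables (G : groupType) (A : vert Gam -> int -> G) (t : edge Gam -> G).
Hypothesis gG : gbs_group T p q A t.
Hypothesis noc : forall c : seq (dart Gam), circuit c ->
  ~ {in c, forall d, d.1 \in T}.
Hypothesis conT : forall u v, connect (adj T) u v.
Variables (W : G -> nat) (X : seq G).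
Hypothesis WX : word_metric W X.

Lemma A_scale v w g a b k : g * A v a = A w b * g ->
  g * A v (a * k)%R = A w (b * k)%R * g.
Proof.
move=> e; elim/int_ind: k => [|n IH|n IH].
- by rewrite !mulr0 !(A0 gG) mulg1 mul1g.
- by rewrite intS !mulrDr !mulr1 !(gbs_AD gG) mulgA e -mulgA IH mulgA.
have eN : g * A v (- a)%R = A w (- b)%R * g.
  by rewrite !(AN gG); apply: (@mulgI _ (A w b)); rewrite mulVKg mulgA -e mulgK.
by rewrite intS opprD !mulrDr !mulrN1 !(gbs_AD gG) mulgA eN -mulgA IH mulgA.
Qed.

(** Each tree edge, its letter being trivial, identifies powers of the generators at its ends; these
    identities are composed along a tree path. *)
Lemma A_commensurable v w : exists a b, [/\ a != 0%R, b != 0%R & A v a = A w b].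
Proof.
have /connectP[r rP ->] := conT v w; elim: r v rP => [|u r IH] v /=.
  by exists 1%R, 1%R.
case/andP => /existsP[d /and3P[dT /eqP <- /eqP <-]] /IH[a [b [a0 b0 e]]].
have p0 := gbs_p0 gG; have q0 := gbs_q0 gG.
exists (lab p q d * a)%R, (b * lab p q (drev d))%R; split.
- by rewrite mulf_neq0 ?lab_neq0.
- by rewrite mulf_neq0 ?lab_neq0.
have := dart_rel gG d a; have -> : tval t d = 1.
  by rewrite /tval (gbs_tree gG dT) invg1; case: ifP.
rewrite mul1g mulg1 => <-; rewrite mulrC.
by have := @A_scale (dtgt d) (last (dtgt d) r) 1 a b (lab p q (drev d));
   rewrite !mul1g !mulg1; apply.
Qed.

Section Affine.
Variables (s : vert Gam -> rat) (lam cc : G -> rat).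
Hypotheses (s0 : forall v, s v != 0%R) (lam1 : lam 1 = 1%R)
  (lam0 : forall g, lam g != 0%R)
  (lamM : forall g h, lam (g * h) = (lam g * lam h)%R)
  (ccM : forall g h, cc (g * h) = (cc g + lam g * cc h)%R)
  (lamA : forall v m, lam (A v m) = 1%R)
  (ccA : forall v m, cc (A v m) = (s v * m%:~R)%R).

Lemma cc1 : cc 1 = 0%R.
Proof.
have := ccM 1 1; rewrite mulg1 lam1 mul1r => /eqP.
by rewrite -subr_eq0 opprD addrA subrr add0r oppr_eq0 => /eqP.
Qed.

Lemma conj_A_lam g v w a b : g * A v a = A w b * g ->
  (lam g * (s v * a%:~R) = s w * b%:~R)%R.
Proof.
move/(congr1 cc); rewrite !ccM !ccA lamA mul1r addrC.
exact: addIr.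
Qed.

Lemma conj_A_eq0 g v w a b : g * A v a = A w b * g -> a != 0%R -> b != 0%R.
Proof.
move/conj_A_lam => e a0; apply: contraNneq a0 => b0.
by move/eqP: e; rewrite b0 mulr0 !mulf_eq0 (negbTE (lam0 g)) (negbTE (s0 v)) intr_eq0.
Qed.

Lemma conj_A_exists g v : exists a b, a != 0%R /\ g * A v a = A v b * g.
Proof.
elim/(gbs_ind gG): g => [|g h [a [b [a0 e]]] [c [d [c0 f]]]|g [a [b [a0 e]]]|u m|e].
- by exists 1%R, 1%R; rewrite mul1g mulg1.
- exists (c * a)%R, (b * d)%R; split; first by rewrite mulf_neq0.
  by rewrite -mulgA (A_scale _ f) !mulgA mulrC (A_scale _ e).
- exists b, a; split; first exact: conj_A_eq0 e a0.
  by apply: (@mulgI _ g); rewrite mulVKg mulgA e mulgK.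
- have [a [b [a0 b0 e]]] := A_commensurable v u.
  by exists a, a; rewrite e (A_comm gG); split.
have [a [b [a0 b0 e1]]] := A_commensurable v (tgt e).
have [c [d [c0 d0 e2]]] := A_commensurable v (src e).
have p0 := gbs_p0 gG e; have q0 := gbs_q0 gG e.
exists (a * (q e * d))%R, (c * (p e * b))%R; split; first by rewrite !mulf_neq0.
have S w x y k : A v x = A w y -> A v (x * k)%R = A w (y * k)%R.
  by have := @A_scale v w 1 x y k; rewrite !mul1g !mulg1.
rewrite (S _ _ _ _ e1) (S _ _ _ _ e2).
by rewrite mulrCA (gbs_rel gG) (mulrC b) mulrCA.
Qed.

Lemma exists_K_conj v : exists2 K, (0 < K)%N &
  forall g, exists M b, [/\ M != 0%R, (`|M| <= K ^ W g)%N & g * A v M = A v b * g].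
Proof.
have [||K KP] := @seq_bound G X (fun K x => exists a b,
    [/\ a != 0%R, (`|a| <= K)%N & x * A v a = A v b * x]).
- by move=> m n x mn [a [b [a0 am e]]]; exists a, b; split=> //; exact: leq_trans mn.
- by move=> x; have [a [b [a0 e]]] := conj_A_exists x v; exists `|a|%N, a, b.
exists K.+1 => //; apply: (wm_ind WX (P := fun n g => exists M b,
  [/\ M != 0%R, (`|M| <= K.+1 ^ n)%N & g * A v M = A v b * g])).
  by exists 1%R, 1%R; rewrite mul1g mulg1.
move=> x n g /KP[a [b [a0 aK e]]] [M [c [M0 MK f]]].
exists (M * a)%R, (b * c)%R; split; first by rewrite mulf_neq0.
  by rewrite abszM expnS mulnC leq_mul // (leq_trans aK).
by rewrite -mulgA (A_scale _ f) !mulgA mulrC (A_scale _ e).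
Qed.

(** The denominator [D] of [lam g] is recorded because it bounds [|1 - lam g|] below by [1 / D] when
    [lam g] is not 1. *)
Lemma affine_growth : exists2 K, (0 < K)%N & forall g,
  [/\ `|lam g| <= (K ^ W g)%:R, `|cc g| <= (K ^ W g)%:R
    & exists D : nat, [/\ (0 < D)%N, (D <= K ^ W g)%N & exists z : int, lam g * D%:R = z%:~R]]%R.
Proof.
have [||K KP] := @seq_bound G X (fun K x => [/\ `|lam x| <= K%:R, `|cc x| <= K%:R
    & exists D : nat, [/\ (0 < D)%N, (D <= K)%N & exists z : int, lam x * D%:R = z%:~R]]%R).
- move=> m n x mn [l c [D [D0 Dm Dz]]].
  have mn' : (m%:R <= n%:R :> rat)%R by rewrite ler_nat.
  split; [exact: le_trans mn'|exact: le_trans mn'|].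
  by exists D; split=> //; exact: leq_trans mn.
- move=> x; have [k1 k1P] := rat_bound `|lam x|%R; have [k2 k2P] := rat_bound `|cc x|%R.
  exists (k1 + k2 + `|denq (lam x)|)%N; rewrite !natrD; split.
  + by apply: le_trans k1P _; rewrite -addrA lerDl addr_ge0.
  + by apply: le_trans k2P _; rewrite addrAC lerDr addr_ge0.
  exists `|denq (lam x)|%N; split; first by rewrite absz_gt0 denq_neq0.
    by rewrite leq_addl.
  exists (numq (lam x)); rewrite -{1}(divq_num_den (lam x)).
  rewrite -[X in (_ * X)%R]/(`|denq (lam x)|%N%:Z%:~R)%R absz_denq.
  by rewrite divfK // intr_eq0 denq_neq0.
(* The base [2 * K + 1] absorbs the sum in [cc (x * g) = cc x + lam x * cc g]. *)
exists (K + K).+1 => //; apply: (wm_ind WX (P := fun n g =>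
  [/\ `|lam g| <= ((K + K).+1 ^ n)%:R, `|cc g| <= ((K + K).+1 ^ n)%:R
    & exists D : nat, [/\ (0 < D)%N, (D <= (K + K).+1 ^ n)%N &
        exists z : int, lam g * D%:R = z%:~R]]%R)).
  rewrite lam1 expn0 normr1; split=> //.
    by rewrite cc1 normr0.
  by exists 1%N; split=> //; exists 1%R; rewrite mulr1.
move=> x n g /KP[lx cx [D [D0 DK [z Dz]]]] [lg cg [D' [D'0 D'K [z' Dz']]]].
have Kn1 : (1 <= ((K + K).+1 ^ n)%:R :> rat)%R by rewrite ler1n expn_gt0.
have K0 : (0 <= K%:R :> rat)%R by rewrite ler0n.
have KS : (((K + K).+1 ^ n.+1)%:R = (1 + K%:R + K%:R) * ((K + K).+1 ^ n)%:R :> rat)%R.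
  by rewrite expnS natrM -nat1r natrD addrA.
rewrite lamM ccM KS normrM; split.
- apply: le_trans (_ : K%:R * ((K + K).+1 ^ n)%:R <= _)%R; first by rewrite ler_pM.
  by rewrite ler_pM2r ?ltr0n ?expn_gt0 //; lra.
- apply: le_trans (ler_normD _ _) _; rewrite normrM.
  have : (`|lam x| * `|cc g| <= K%:R * ((K + K).+1 ^ n)%:R)%R by rewrite ler_pM.
  move: Kn1; set k := (_ ^ _)%:R%R => k1 h; nra.
exists (D * D')%N; split; first by rewrite muln_gt0 D0.
  by rewrite expnS leq_mul // (leq_trans DK) //; lia.
exists (z * z')%R; rewrite intrM -Dz -Dz' natrM; ring.
Qed.

(** [cc (A v m)] is [m] times the constant [s v]; the successor in the exponent absorbs that
    constant. *)
Lemma exponent_growth : exists2 K, (0 < K)%N &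
  forall v m, (`|m| <= K ^ (W (A v m)).+1)%N.
Proof.
have [K K0 KP] := affine_growth.
have [||N NP] := @fin_bound (vert Gam) (fun N v => 1 <= `|s v| * N%:R)%R.
- move=> m n v mn h; apply: le_trans h _; apply: ler_wpM2l; first exact: normr_ge0.
  by rewrite ler_nat.
- move=> v; have [n nP] := rat_bound (`|s v|^-1)%R; exists n.
  have sv : (0 < `|s v|)%R by rewrite normr_gt0.
  by rewrite mulrC -ler_pdivrMr // mul1r.
exists (N * K).+1 => // v m; have [_ c _] := KP (A v m).
apply: absz_le_rat; move: c (NP v); rewrite ccA normrM.
set k := W _ => c sN.
have : (`|m%:~R : rat| <= (N * K ^ k)%:R)%R.
  rewrite natrM -[leLHS]mul1r; apply: (@le_trans _ _ (`|s v| * N%:R * `|m%:~R|)%R).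
    by rewrite ler_wpM2r.
  by rewrite mulrAC mulrC ler_wpM2l.
move/le_trans; apply; rewrite ler_nat.
apply: (@leq_trans (N * (N * K).+1 ^ k)); last first.
  by rewrite expnS leq_mul2r; apply/orP; right; nia.
rewrite leq_mul2l; apply/orP; have [->|N0] := posnP N; [by left|right].
by case: (k) => // k'; rewrite leq_exp2r //; nia.
Qed.

Lemma wm_A_abs v (z : int) : (W (A v z) <= W (A v `|z|%N))%N.
Proof.
have [->|->] : z = `|z|%N :> int \/ z = (- `|z|%N%:Z)%R by lia.
  by [].
by rewrite (AN gG) abszN absz_nat; exact: (wmV WX).
Qed.

(* Euclidean division by |a|, then conjugation by g, shrinks the exponent by the
   factor |b| / |a| at bounded cost. *)
Lemma distorted v g (a b : int) K : (0 < K)%N -> (`|b| < `|a|)%N ->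
  g * A v a = A v b * g ->
  exists D, forall n z, (`|z| <= K ^ n)%N -> (W (A v z) <= D * n.+1)%N.
Proof.
move=> K0 ba e; have a0 : a != 0%R by rewrite -absz_gt0; apply: leq_ltn_trans ba.
have [b' b'b {}e] : exists2 b', (`|b'| < `|a|)%N & g * A v (`|a|%N) = A v b' * g.
  have [c cb <-] : exists2 c : int, `|c|%N = 1%N & (a * c)%R = `|a|%N.
    by have [?|?] := leP 0%R a; [exists 1%R | exists (- 1)%R] => //; lia.
  by exists (b * c)%R; [rewrite abszM cb muln1|exact: A_scale e].
move: e b'b; set M := `|a|%N => e b'M.
have M0 : (0 < M)%N by rewrite absz_gt0.
(* A step pays for one remainder modulo [M] and for [g] on both sides. *)
pose C := (\max_(r < M) W (A v r) + W g + W g)%N.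
have [|z|D DP] := @descent nat id (fun n z => W (A v z%:Z) <= n)%N M.-1 C K K0.
- by move=> _ ->; rewrite (A0 gG) (wm1 WX).
- right; exists (`|b'| * (z %/ M))%N; rewrite prednK //; split.
    rewrite mulnCA; apply: leq_mul; first by rewrite -ltnS prednK.
    by rewrite mulnC leq_divM.
  move=> n Qn; rewrite {1}(divn_eq z M) addnC PoszD (gbs_AD gG) mulnC PoszM.
  have -> : A v (M%:Z * (z %/ M)%N)%R = g^-1 * A v (b' * (z %/ M)%N)%R * g.
    by rewrite -mulgA -(A_scale _ e) mulKg.
  set u := A v (b' * _)%R.
  have hu : (W u <= n)%N by apply: leq_trans (wm_A_abs _ _) _; rewrite abszM.
  have hr := @leq_bigmax _ (fun r : 'I_M => W (A v r)) (Ordinal (ltn_pmod z M0)).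
  have := wmM WX (A v (z %% M)%N) (g^-1 * u * g); have := wmM WX (g^-1 * u) g.
  have := wmM WX g^-1 u; have := wmV WX g; rewrite /C; move: hr hu => /=.
  move: (\max_(r < M) _)%N (W (_ * _)) (W (g^-1 * u * g)) (W (g^-1 * u)) (W g^-1).
  by move: (W u) (W g) (W (A v (z %% M)%N)) => *; lia.
exists D => n z /DP[k kD kP]; apply: leq_trans (wm_A_abs _ _) _.
exact: leq_trans kP kD.
Qed.

(** If [g] conjugates [A v a] to [A v b], then [|lam g| = |b| / |a|], so either [g] or its inverse
    contracts exponents. *)
Lemma nonunimodular_distorted g v K : (0 < K)%N -> `|lam g|%R != 1%R ->
  exists D, forall n z, (`|z| <= K ^ n)%N -> (W (A v z) <= D * n.+1)%N.
Proof.
move=> K0 lg; have [a [b [a0 e]]] := conj_A_exists g v.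
have b0 := conj_A_eq0 e a0.
case: (ltngtP `|a| `|b|) => ab.
- apply: (@distorted v g^-1 b a) => //.
  by apply: (@mulgI _ g); rewrite mulVKg mulgA e mulgK.
- exact: distorted e.
have := congr1 Num.norm (conj_A_lam e); rewrite !normrM -!intr_norm -!abszE ab.
move/eqP; rewrite -{2}[(`|s v| * _)%R]mul1r -subr_eq0 -mulrBl mulf_eq0 subr_eq0.
by rewrite (negbTE lg) mulf_eq0 normr_eq0 (negbTE (s0 v)) intr_eq0 eqz_nat absz_eq0 (negbTE b0).
Qed.

Lemma centralizer_mod v g h z M : M != 0%R -> g * A v M = A v M * g ->
  A v z * g = h * A v z ->
  A v (z %% M)%Z * g = h * A v (z %% M)%Z /\ (`|(z %% M)%Z| < `|M|)%N.
Proof.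
move=> M0 cM e; split; last first.
  by have := modz_ge0 z M0; have := ltz_mod z M0; lia.
have -> : (z %% M)%Z = (z + M * - (z %/ M)%Z)%R.
  by rewrite {2}(divz_eq z M); ring.
by rewrite (gbs_AD gG) -mulgA -(A_scale _ cM) !mulgA e.
Qed.

(** Choose one [N] that every generator in [X] conjugates into the group of [v]. As all moduli are
    1, the result is [A v N] or its inverse, so this extends to all [g]; [lam g = 1] then selects
    the sign. *)
Lemma unimodular_commute v : (forall g, `|lam g|%R = 1%R) ->
  exists2 N, N != 0%R & forall g, lam g = 1%R -> g * A v N = A v N * g.
Proof.
move=> uni.
have [N N0 NP] : exists2 N, N != 0%R & forall x, x \in X -> exists b, x * A v N = A v b * x.
  elim: (X) => [|x r [N N0 NP]]; first by exists 1%R.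
  have [a [b [a0 e]]] := conj_A_exists x v.
  exists (a * N)%R; first by rewrite mulf_neq0.
  move=> y; rewrite inE => /predU1P[->|/NP[c f]].
    by exists (b * N)%R; rewrite (A_scale _ e).
  by exists (c * a)%R; rewrite mulrC (A_scale _ f).
exists N => // g lg1.
have H : forall g, exists b, g * A v N = A v b * g /\ (b = N \/ b = - N)%R.
  move=> g'; suff [b e] : exists b, g' * A v N = A v b * g'.
    exists b; split=> //; have := congr1 Num.norm (conj_A_lam e).
    rewrite !normrM uni mul1r => /(mulfI _); rewrite normr_eq0 => /(_ (s0 v)).
    by move/eqP; rewrite -!intr_norm eqr_int; lia.
  pose P (n : nat) g' := exists b, g' * A v N = A v b * g' /\ (b = N \/ b = - N)%R.
  suff /(_ g')[b [e _]] : forall g', P (W g') g' by exists b.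
  apply: (wm_ind WX (P := P)) => [|x n g1 /NP[c e] [b [f bN]]].
    by exists N; rewrite mul1g mulg1; split; [|left].
  have cN : (c = N \/ c = - N)%R.
    have := congr1 Num.norm (conj_A_lam e).
    rewrite !normrM uni mul1r => /(mulfI _); rewrite normr_eq0 => /(_ (s0 v)).
    by move/eqP; rewrite -!intr_norm eqr_int; lia.
  have [k bk] : exists k : int, b = (N * k)%R /\ (k = 1 \/ k = - 1)%R.
    by case: bN => ->; [exists 1%R|exists (-1)%R]; split; lia.
  exists (c * k)%R; split; last lia.
  by rewrite -mulgA f (proj1 bk) mulgA (A_scale _ e) mulgA.
have [b [e _]] := H g; have := conj_A_lam e; rewrite lg1 mul1r => /(mulfI (s0 v)).
by move/eqP; rewrite eqr_int => /eqP Nb; rewrite {2}Nb.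
Qed.

(** The action is now by isometries of Q, so displacements of 0 add up linearly. *)
Lemma unimodular_growth : (forall g, `|lam g|%R = 1%R) ->
  exists K : nat, forall g, (`|cc g| <= (K * W g)%:R)%R.
Proof.
move=> uni.
have [||K KP] := @seq_bound G X (fun K x => `|cc x| <= K%:R)%R.
- by move=> m n x mn h; apply: le_trans h _; rewrite ler_nat.
- by move=> x; exact: rat_bound.
exists K; apply: (wm_ind WX (P := fun n g => `|cc g| <= (K * n)%:R)%R).
  by rewrite cc1 normr0 muln0.
move=> x n g /KP cx cg; rewrite ccM mulnS natrD.
by apply: le_trans (ler_normD _ _) _; rewrite lerD // normrM uni mul1r.
Qed.

Lemma wm_A_lin v z : (W (A v z) <= W (A v 1%R) * `|z|)%N.
Proof.
apply: leq_trans (wm_A_abs _ _) _; elim: `|z|%N => [|n IH].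
  by rewrite (A0 gG) (wm1 WX).
by rewrite intS (gbs_AD gG); apply: leq_trans (wmM WX _ _) _; rewrite mulnS leq_add2l.
Qed.

Lemma s_bound v : exists N : nat, (1 <= `|s v| * N%:R)%R.
Proof.
have [n nP] := rat_bound (`|s v|^-1)%R; exists n.
by rewrite mulrC -ler_pdivrMr ?mul1r // normr_gt0.
Qed.

Lemma conj_lam_cc v g h z : A v z * g = h * A v z ->
  lam g = lam h /\ ((1 - lam g) * (s v * z%:~R) = cc h - cc g)%R.
Proof.
move=> e; have lgh : lam g = lam h.
  by have := congr1 lam e; rewrite !lamM lamA mul1r mulr1.
split=> //; have := congr1 cc e; rewrite !ccM lamA mul1r ccA -lgh => e'.
by move: e'; rewrite mulrBl !mul1r; lra.
Qed.

(* The equation for z is (1 - lam g) * s v * z = cc h - cc g. If lam g = 1, then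
   g centralizes some A v M with M small, and z may be reduced modulo M;
   otherwise it bounds z. An exponential bound is enough when some modulus is
   not 1, as A v is then exponentially distorted. *)
Lemma vertex_conj_bound v : exists C, forall g h z, A v z * g = h * A v z ->
  exists z', A v z' * g = h * A v z' /\ (W (A v z') <= C * (W g + W h).+1)%N.
Proof.
have [N NP] := s_bound v.
have [[g0 lg0]|uni] := pselect (exists g0, `|lam g0|%R != 1%R).
  have [K1 K1_0 K1P] := exists_K_conj v; have [K2 K2_0 K2P] := affine_growth.
  (* [K1] serves the reduction modulo a centralizing exponent, [2 * N * K2 ^ 2] the bound
     [N * a * (a + b)] obtained below when [lam g] is not 1. *)
  pose K := (K1 + 2 * N * K2 ^ 2)%N.
  have K0 : (0 < K)%N by rewrite addn_gt0 K1_0.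
  have [D DP] := nonunimodular_distorted v K0 lg0.
  exists (2 * D)%N => g h z e; have [lg1|lg1] := eqVneq (lam g) 1%R.
    have [M [b [M0 MK f]]] := K1P g; have := conj_A_lam f.
    rewrite lg1 mul1r => /(mulfI (s0 v)) /eqP; rewrite eqr_int => /eqP Mb.
    rewrite -Mb in f; have [e' lt] := centralizer_mod M0 f e.
    exists (z %% M)%Z; split=> //; apply: leq_trans (DP (W g) _ _) _; last by nia.
    apply: leq_trans (ltnW lt) (leq_trans MK _).
    by case: (W g) => // n; rewrite leq_exp2r // leq_addr.
  exists z; split=> //; apply: leq_trans (DP (W g + W h).+1 _ _) _; last by nia.
  have [_ zE] := conj_lam_cc e.
  have [_ cg [d [d0 dK [k kE]]]] := K2P g; have [_ ch _] := K2P h.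
  set a := (K2 ^ W g)%N in cg dK; set b := (K2 ^ W h)%N in ch.
  (* Since [lam g = k / d] differs from 1, the integer [d - k] is not 0. *)
  have k0 : (1 <= `|(d%:Z - k)%:~R : rat|)%R.
    rewrite -intr_norm -[1%R]/(1%:~R)%R ler_int -gtz0_ge1 normr_gt0 subr_eq0.
    apply: contra_neq lg1 => dk; have d0' : (d%:R != 0 :> rat)%R by rewrite pnatr_eq0 -lt0n.
    by apply: (mulIf d0'); rewrite kE -dk mul1r.
  have e1 : ((d%:Z - k)%:~R * (s v * z%:~R) = d%:R * (cc h - cc g))%R.
    by rewrite -zE intrB -kE -[(d%:Z)%:~R]/(d%:R); ring.
  have le1 : (`|z%:~R : rat| <= (N * (a * (a + b)))%:R)%R.
    have z0 : (0 <= `|z%:~R : rat|)%R by [].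
    have sz0 : (0 <= `|s v| * `|z%:~R|)%R by rewrite mulr_ge0.
    apply: (@le_trans _ _ (N%:R * (`|s v| * `|z%:~R|))%R).
      by rewrite mulrA [(N%:R * _)%R]mulrC -[leLHS]mul1r ler_wpM2r.
    rewrite natrM ler_wpM2l //.
    apply: (@le_trans _ _ (`|(d%:Z - k)%:~R| * (`|s v| * `|z%:~R|))%R).
      by rewrite -[leLHS]mul1r ler_wpM2r.
    rewrite -!normrM e1 normrM natrM ger0_norm // ler_pM //; first by rewrite ler_nat.
    apply: le_trans (ler_normB _ _) _; rewrite natrD addrC; exact: lerD.
  apply: leq_trans (absz_le_rat le1) _.
  have a0 : (0 < a)%N by rewrite expn_gt0 K2_0.
  have b0 : (0 < b)%N by rewrite expn_gt0 K2_0.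
  apply: (@leq_trans (2 * N * (K2 ^ 2) ^ (W g + W h))).
    rewrite expnAC expnD -/a -/b -mulnA [leqRHS]mulnCA leq_mul2l; apply/orP; right.
    have : (0 < a * b)%N by rewrite muln_gt0 a0.
    by rewrite mulnDr expnS expn1; nia.
  rewrite [leqRHS]expnS; apply: leq_mul; first by rewrite /K; nia.
  case: (W g + W h)%N => // n; rewrite leq_exp2r // /K.
  suff : (0 < N)%N by nia.
  by move: NP; case: (N) => //; rewrite mulr0; lra.
have {}uni g : `|lam g|%R = 1%R by apply: contrapT => /eqP ng; apply: uni; exists g.
have [M M0 MP] := unimodular_commute v uni; have [K KP] := unimodular_growth uni.
exists (W (A v 1%R) * (`|M| + N * K))%N => g h z e.
have [lg1|lg1] := eqVneq (lam g) 1%R.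
  have [e' lt] := centralizer_mod M0 (MP g lg1) e.
  exists (z %% M)%Z; split=> //; apply: leq_trans (wm_A_lin _ _) _.
  rewrite -mulnA leq_mul2l; apply/orP; right.
  by apply: leq_trans (ltnW lt) _; rewrite mulnS -addnA leq_addr.
exists z; split=> //; apply: leq_trans (wm_A_lin _ _) _.
rewrite -mulnA leq_mul2l; apply/orP; right.
(* The equation becomes [2 * s v * z = cc h - cc g], whose right side is linear in the lengths. *)
have lgN : lam g = (-1)%R.
  have := uni g; have [g0|g0] := leP 0%R (lam g).
    by rewrite ger0_norm // => /eqP; rewrite (negbTE lg1).
  by rewrite ltr0_norm // => /eqP; rewrite eqr_oppLR => /eqP.
have [_ zE] := conj_lam_cc e; rewrite lgN in zE.
have le1 : (`|z%:~R : rat| <= (N * (K * (W g + W h)))%:R)%R.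
  apply: (@le_trans _ _ (N%:R * (`|s v| * `|z%:~R|))%R).
    by rewrite mulrA [(N%:R * _)%R]mulrC -[leLHS]mul1r ler_wpM2r.
  rewrite natrM ler_wpM2l // mulnDr natrD.
  have := KP g; have := KP h; have := ler_normB (cc h) (cc g); rewrite -zE.
  rewrite !normrM; have -> : (1 - -1 = 2 :> rat)%R by lra.
  rewrite ger0_norm //; have : (0 <= `|s v| * `|z%:~R : rat|)%R by rewrite mulr_ge0.
  by lra.
by apply: leq_trans (absz_le_rat le1) _; nia.
Qed.

Lemma vertex_conj_bound_uniform : exists C, forall v g h z, A v z * g = h * A v z ->
  exists z', A v z' * g = h * A v z' /\ (W (A v z') <= C * (W g + W h).+1)%N.
Proof.
apply: fin_bound => [m n v mn H g h z /H[z' [e le]]|]; last exact: vertex_conj_bound.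
by exists z'; split=> //; apply: leq_trans le _; rewrite leq_mul2r mn orbT.
Qed.

End Affine.
End Quantitative.

(** * Cyclic reduction and conjugacy of words *)

Lemma sorted_rcons_cat (I : Type) (e : rel I) s x y s' :
  sorted e (rcons s x) -> e x y -> sorted e (y :: s') ->
  sorted e (rcons s x ++ y :: s').
Proof.
by case: s => [|z s] /= h exy h'; rewrite ?exy // cat_path h /= last_rcons exy.
Qed.

Lemma sorted_rconsW (I : Type) (e : rel I) s x : sorted e (rcons s x) -> sorted e s.
Proof. by case: s => //= y s; rewrite rcons_path => /andP[]. Qed.

Lemma rot_rot_ex (I : Type) m n (s : seq I) : exists k, rot m (rot n s) = rot k s.
Proof.
have [ln|/ltnW ln] := leqP n (size s); last by rewrite (rot_oversize ln); exists m.
have [lm|/ltnW lm] := leqP m (size s); last by exists n; rewrite rot_oversize // size_rot.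
by exists (if (m + n <= size s)%N then m + n else m + n - size s)%N; rewrite rot_add_mod.
Qed.

Section WordTheory.
Variables (Gam : graph_of_groups) (T : {set edge Gam}) (p q : edge Gam -> int).
Variables (G : groupType) (A : vert Gam -> int -> G) (t : edge Gam -> G).
Hypothesis gG : gbs_group T p q A t.
Hypothesis noc : forall c : seq (dart Gam), circuit c ->
  ~ {in c, forall d, d.1 \in T}.
Hypothesis conT : forall u v, connect (adj T) u v.
Variables (W : G -> nat) (X : seq G).
Hypothesis WX : word_metric W X.
Variable C0 : nat.
Hypothesis tC0 : forall d, (W (tval t d) <= C0)%N.

Local Notation lab := (lab p q).
Local Notation td := (tval t).
Local Notation wv := (wval A t).
Local Notation nopinch := (nopinch p q).
Implicit Types (w : seq (int * dart Gam)).

Fixpoint cost w : nat :=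
  if w is l :: w' then (W (A (dsrc l.2) l.1) + C0 + cost w')%N else 0%N.

Lemma cost_cat w1 w2 : cost (w1 ++ w2) = (cost w1 + cost w2)%N.
Proof. by elim: w1 => //= l w1 ->; rewrite !addnA. Qed.

Lemma wm_wval w : (W (wv w) <= cost w)%N.
Proof.
elim: w => [|l w IH] /=; first by rewrite (wm1 WX).
have := wmM WX (A (dsrc l.2) l.1 * td l.2) (wv w).
have := wmM WX (A (dsrc l.2) l.1) (td l.2); have := tC0 l.2; lia_lengths W.
Qed.

Lemma wval_rot i w : wv w * wv (take i w) = wv (take i w) * wv (rot i w).
Proof. by rewrite -{1}(cat_take_drop i w) !wval_cat mulgA. Qed.

Lemma addlP j x w y f : pathw x w y ->
  [/\ pathw x (addl j w f).1 y,
      wv (addl j w f).1 * A y (addl j w f).2 = A x j * (wv w * A y f),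
      sorted nopinch w -> sorted nopinch (addl j w f).1 &
      size (addl j w f).1 = size w].
Proof.
case: w => [|l w] /=; first by move/eqP->; rewrite !mul1g (gbs_AD gG) eqxx.
case/andP => /eqP <- pw; rewrite eqxx pw (gbs_AD gG) !mulgA; split=> //.
by case: w pw => //= l' w _ /andP[].
Qed.

Lemma addl_cost j x w y f : pathw x w y ->
  (cost (addl j w f).1 + W (A y (addl j w f).2) <= W (A x j) + (cost w + W (A y f)))%N.
Proof.
case: w => [|l w] /=; first by move/eqP->; rewrite (gbs_AD gG); exact: wmM WX _ _.
case/andP => /eqP <- pw; rewrite (gbs_AD gG).
by have := wmM WX (A (dsrc l.2) j) (A (dsrc l.2) l.1); lia_lengths W.
Qed.

Lemma pinch_val d k :
  td d * A (dtgt d) (lab (drev d) * k)%R * td (drev d) = A (dsrc d) (lab d * k)%R.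
Proof. by rewrite (dart_rel gG) tval_drev mulgK. Qed.

(** The two terms [C0] are what [cost] charges for the two darts of the pinch. *)
Lemma pinch_cost d k : (W (A (dsrc d) (lab d * k)%R) <=
  C0 + W (A (dtgt d) (lab (drev d) * k)%R) + C0)%N.
Proof.
rewrite -pinch_val; have := wmM WX (td d * A (dtgt d) (lab (drev d) * k)%R) (td (drev d)).
have := wmM WX (td d) (A (dtgt d) (lab (drev d) * k)%R).
by have := tC0 d; have := tC0 (drev d); lia_lengths W.
Qed.

Lemma pinchP l l' : ~~ nopinch l l' ->
  l'.2 = drev l.2 /\ exists k, l'.1 = (lab (drev l.2) * k)%R.
Proof.
rewrite negbK => /andP[/eqP e]; rewrite e => /dvdzP[k ->].
by split=> //; exists k; rewrite mulrC.
Qed.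

Lemma reduce_word x w y f : pathw x w y -> exists w' f',
  [/\ pathw x w' y, sorted nopinch w', wv w' * A y f' = wv w * A y f,
      (cost w' + W (A y f') <= cost w + W (A y f))%N & (size w' <= size w)%N].
Proof.
elim: w x => [|l w IH] x pw; first by exists [::], f.
move: (pw) => /= /andP[/eqP dx /IH[w1 [f1 [p1 s1 e1 c1 z1]]]].
have [s2|] := boolP (sorted nopinch (l :: w1)).
  exists (l :: w1), f1; split=> //=; first by rewrite dx eqxx.
    by rewrite -!mulgA e1.
  by lia_lengths W.
case: w1 => [//|l2 w2] in p1 s1 e1 c1 z1 *.
rewrite /= negb_and (_ : path nopinch l2 w2 = true) // orbF => /pinchP[d2 [k k2]].
move: p1 => /= /andP[_ p2]; rewrite d2 dtgt_drev in p2.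
have := addl_cost (l.1 + lab l.2 * k)%R f1 p2.
have := addlP (l.1 + lab l.2 * k)%R f1 p2.
case: addl => w3 f3 /= [p3 e3 s3 z3] c3.
exists w3, f3; split=> //.
- by rewrite -dx.
- by apply: s3; apply: path_sorted s1.
- rewrite e3 (gbs_AD gG) -pinch_val -[RHS]mulgA -e1 /= d2 k2 dsrc_drev.
  by rewrite !mulgA.
- move: c1 c3; rewrite /= k2 d2 dsrc_drev (gbs_AD gG).
  have := wmM WX (A (dsrc l.2) l.1) (A (dsrc l.2) (lab l.2 * k)%R).
  by have := pinch_cost l.2 k; lia_lengths W.
by move: z1; rewrite /= z3; lia.
Qed.

(** Tree paths have trivial value, so any two vertices can serve as endpoints and the words of
    factors can be joined. *)
Lemma path_word g x y : exists w f, pathw x w y /\ g = wv w * A y f.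
Proof.
have cat x1 x2 x3 g1 g2 : (exists w f, pathw x1 w x2 /\ g1 = wv w * A x2 f) ->
    (exists w f, pathw x2 w x3 /\ g2 = wv w * A x3 f) ->
    exists w f, pathw x1 w x3 /\ g1 * g2 = wv w * A x3 f.
  move=> [w1 [f1 [p1 ->]]] [w2 [f2 [p2 ->]]]; have := addlP f1 f2 p2.
  case: addl => w3 f3 /= [p3 e3 _ _]; exists (w1 ++ w3), f3.
  by rewrite wval_cat (pathw_cat p1 p3) -!mulgA e3; split.
have one u v : exists w f, pathw u w v /\ 1 = wv w * A v f.
  have /connectP[r rP ->] := conT u v; elim: r u rP => [|z r IH] u.
    by exists [::], 0%R; rewrite /= eqxx (A0 gG) mulg1.
  case/andP => /existsP[d /and3P[dT /eqP <- /eqP <-]] /IH[w [f [pw e]]].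
  exists ((0%R, d) :: w), f; split; first by rewrite /= eqxx.
  rewrite /= (A0 gG) mul1g -mulgA -e mulg1.
  by rewrite /tval (gbs_tree gG dT) invg1; case: ifP.
elim/(gbs_ind gG): g x y => [|g h IHg IHh|g IH|v m|e] x y; first exact: one.
- exact: cat (IHg x x) (IHh x y).
- have [w [f [pw ->]]] := IH y x; elim: w y pw => [|l w IHw] y.
    move=> /= /eqP ->; exists [::], (- f)%R.
    by rewrite /= eqxx !mul1g (AN gG).
  case/andP => /eqP <- /IHw {}IHw.
  have -> : (wv (l :: w) * A x f)^-1 =
      (wv w * A x f)^-1 * (td (drev l.2) * A (dsrc l.2) (- l.1)%R).
    by rewrite (AN gG) tval_drev /= !invgM !mulgA.
  apply: (cat) IHw _; exists [:: (0%R, drev l.2)], (- l.1)%R.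
  by rewrite /= dsrc_drev dtgt_drev !eqxx (A0 gG) mul1g mulg1.
- have := cat _ _ _ _ _ (one x v) (one v y); rewrite mulg1 => _.
  suff /(cat _ _ _ _ _ (one x v)) : exists w f, pathw v w y /\ A v m = wv w * A y f.
    by rewrite mul1g.
  rewrite -[A v m]mulg1; apply: cat (one v y).
  by exists [::], m; rewrite /= eqxx mul1g.
suff /(cat _ _ _ _ _ (one x (src e))) : exists w f, pathw (src e) w y /\ t e = wv w * A y f.
  by rewrite mul1g.
rewrite -[t e]mulg1; apply: cat (one (tgt e) y).
by exists [:: (0%R, (e, false))], 0%R; rewrite /= !eqxx !(A0 gG) mul1g !mulg1.
Qed.

(* The conjugator consists of the letters removed from the front, while what they
   leave behind stays in the final exponent: this keeps its length linear. *)
Lemma cyc_red n x w f : (size w <= n)%N -> pathw x w x -> sorted nopinch w ->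
  exists c y w' f', [/\ [/\ pathw y w' y & sorted nopinch w'],
    wv w * A x f * c = c * (wv w' * A y f'), (W c <= cost w)%N,
    (cost w' + W (A y f') <= cost w + W (A x f))%N
    & if w' is l :: w0 then nopinch (last l w0) (f' + l.1, l.2)%R else true].
Proof.
have triv (u : G) : u * 1 = 1 * u by rewrite mulg1 mul1g.
elim: n => [|n IH] in x w f *.
  by case: w => // _ pw _; exists 1, x, [::], f; rewrite (wm1 WX); split; rewrite ?triv.
case: w => [|l w1] zn pw sw.
  by exists 1, x, [::], f; rewrite (wm1 WX); split; rewrite ?triv.
have [np|] := boolP (nopinch (last l w1) (f + l.1, l.2)%R).
  by exists 1, x, (l :: w1), f; rewrite (wm1 WX); split; rewrite ?triv.
move/pinchP => /= [dE [k kE]].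
case: (lastP w1) => [|w2 l2] in zn pw sw dE kE *.
  by have := congr1 snd dE; rewrite /=; case: (l.2.2).
rewrite last_rcons in dE kE.
move: pw => /= /andP[/eqP lx]; rewrite -cats1 => /pathw_catP[y p2].
case/andP => /eqP d2 /eqP ex; subst y x.
have {}p2 : pathw (dtgt l.2) w2 (dtgt l.2) by rewrite {2}dE dtgt_drev.
have s2 : sorted nopinch w2.
  by move: sw => /= /path_sorted; exact: sorted_rconsW.
(* Read cyclically, the last dart, the power [f + l.1] and the first dart collapse to the power
   [lab l2.2 * k], which joins the exponent of the last letter. *)
have [|c [y [w' [f' [pw' e cw ct np]]]]] := IH (dtgt l.2) w2 (l2.1 + lab l2.2 * k)%R _ p2 s2.
  by move: zn; rewrite /= size_rcons; lia.
have esrc : dsrc l.2 = dtgt l2.2 by rewrite dE dsrc_drev.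
have etgt : dsrc l2.2 = dtgt l.2 by rewrite dE dtgt_drev.
have e1 : td l2.2 * A (dtgt l2.2) (f + l.1)%R * td l.2 = A (dtgt l.2) (lab l2.2 * k)%R.
  by rewrite dE kE pinch_val dtgt_drev.
have ee : A (dsrc l.2) l.1 * td l.2 * wv (w2 ++ [:: l2]) * A (dtgt l2.2) f *
      (A (dsrc l.2) l.1 * td l.2) =
    A (dsrc l.2) l.1 * td l.2 * (wv w2 * A (dtgt l.2) (l2.1 + lab l2.2 * k)%R).
  rewrite wval_cat /= mulg1 esrc.
  by rewrite [in RHS](gbs_AD gG) -e1 (gbs_AD gG) -etgt !mulgA.
exists (A (dsrc l.2) l.1 * td l.2 * c), y, w', f'; split=> //.
- by rewrite mulgA ?esrc; rewrite ?esrc in ee; rewrite ee -!mulgA -e !mulgA.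
- rewrite cost_cat /=.
  have := wmM WX (A (dsrc l.2) l.1 * td l.2) c.
  have := wmM WX (A (dsrc l.2) l.1) (td l.2); have := tC0 l.2; lia_lengths W.
apply: leq_trans ct _; rewrite (gbs_AD gG) cost_cat /=.
have := wmM WX (A (dtgt l.2) l2.1) (A (dtgt l.2) (lab l2.2 * k)%R).
have := wmM WX (td l2.2) (A (dtgt l2.2) f * A (dtgt l2.2) l.1 * td l.2).
have := wmM WX (A (dtgt l2.2) f * A (dtgt l2.2) l.1) (td l.2).
have := wmM WX (A (dtgt l2.2) f) (A (dtgt l2.2) l.1).
rewrite -e1 (gbs_AD gG) !mulgA etgt esrc; have := tC0 l.2; have := tC0 l2.2.
lia_lengths W.
Qed.

(** If darts remain after cyclic reduction, conjugating by the final power moves it into the first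
    letter, and the word closes up to a cycle. The factor 2 accounts for that power besides the
    conjugator of [cyc_red]. *)
Lemma cyclic_form x w f : pathw x w x ->
  let tot := (cost w + W (A x f))%N in exists c y, (W c <= 2 * tot)%N /\
    ((exists m, wv w * A x f * c = c * A y m) \/
     exists U, [/\ U != [::], pathw y U y, cycle nopinch U,
                wv w * A x f * c = c * wv U & (cost U <= tot)%N]).
Proof.
move=> pw tot; have [w1 [f1 [p1 s1 e1 c1 _]]] := reduce_word f pw.
have [c [y [w2 [f2 [[p2 s2] e2 cw ct np]]]]] := cyc_red f1 (leqnn _) p1 s1.
rewrite -e1; case: w2 => [|l w2] in p2 s2 e2 ct np *.
  exists c, y; split; first by rewrite /tot; lia.
  by left; exists f2; rewrite e2 mul1g.
exists (c * (A y f2)^-1), y; split.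
  have := wmM WX c (A y f2)^-1; have := wmV WX (A y f2); rewrite /tot; lia_lengths W.
right; have := addl_cost f2 0%R p2; have := addlP f2 0%R p2.
have dl : dsrc l.2 = y by case/andP: p2 => /eqP.
rewrite /= (A0 gG) mulg1 => -[p3 e3 s3 _] c3.
exists ((f2 + l.1, l.2)%R :: w2); split=> //.
- by rewrite [cycle _ _]rcons_path; apply/andP; split; [exact: s3|by case: (w2) np].
- by rewrite mulgA e2 mulgA mulgK /= e3 mulg1 !mulgA mulgVK.
- have := wm1 WX; move: c3 ct => /= c3 ct; rewrite /tot.
  lia_lengths W.
Qed.

Lemma carry_size j w1 f1 w2 f2 : carry p q j w1 f1 w2 f2 -> size w1 = size w2.
Proof. by elim: w1 w2 j => [|l1 w1 IH] [|l2 w2] j //= [_ [k [_ /IH ->]]]. Qed.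

Lemma carry_val j x y w1 f1 w2 f2 : pathw x w1 y -> carry p q j w1 f1 w2 f2 ->
  A x j * (wv w1 * A y f1) = wv w2 * A y f2.
Proof.
elim: w1 w2 j x => [|l1 w1 IH] [|l2 w2] j x //=.
  by move/eqP->; rewrite !mul1g -(gbs_AD gG) => ->.
case/andP => /eqP <- pw [dd [k [jk /(IH _ _ _ pw) e]]].
rewrite !mulgA -(gbs_AD gG) jk -dd (gbs_AD gG) -!mulgA -e !mulgA; congr (_ * _ * _).
by rewrite -!mulgA; congr (_ * _); rewrite -(dart_rel gG).
Qed.

Lemma rotr_pathw x l w : pathw x (rcons w l) x ->
  [/\ dtgt l.2 = x & pathw (dsrc l.2) (l :: w) (dsrc l.2)].
Proof.
rewrite -cats1 => /pathw_catP[y h] /= /andP[/eqP yl /eqP lx]; split=> //.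
by rewrite eqxx lx yl.
Qed.

Lemma pinch_front y lv lc c' x f : pathw y (lc :: c') x -> dtgt lv.2 = y ->
  ~~ nopinch lv lc -> sorted nopinch (lc :: c') ->
  exists c2 f2, [/\ pathw (dsrc lv.2) c2 x, sorted nopinch c2, (size c2 <= size c')%N
    & wv [:: lv] * (wv (lc :: c') * A x f) = wv c2 * A x f2].
Proof.
move=> /= /andP[/eqP ly pc] dy /pinchP[d2 [k k2]] sc.
rewrite d2 dtgt_drev in pc.
have := addlP (lv.1 + lab lv.2 * k)%R f pc; case: addl => c2 f2 /= [p2 e2 s2 z2].
exists c2, f2; split=> //; first by apply: s2; exact: path_sorted sc.
  by rewrite z2.
by rewrite e2 (gbs_AD gG) -pinch_val d2 k2 dsrc_drev mulg1 !mulgA.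
Qed.

Lemma pinch_back y c l lu x f : pathw y (rcons c l) x -> dsrc lu.2 = x ->
  ~~ nopinch l (f + lu.1, lu.2)%R ->
  pathw y c (dtgt lu.2) /\
  exists f2, wv (rcons c l) * A x f * wv [:: lu] = wv c * A (dtgt lu.2) f2.
Proof.
rewrite -cats1 => /pathw_catP[x2 p2] /= /andP[/eqP e2 /eqP xE] lux /pinchP[/= dE [k kE]].
have e3 : dtgt lu.2 = x2 by rewrite dE dtgt_drev.
rewrite e3; split=> //; exists (l.1 + lab l.2 * k)%R.
rewrite wval_cat /= !mulg1 lux -e2 [in RHS](gbs_AD gG) -(pinch_val l.2 k) -kE -dE xE.
by rewrite (gbs_AD gG) !mulgA.
Qed.

Lemma rot_conjr (a b g v : G) : g * (a * b) = v * g -> g * a * (b * a) = v * (g * a).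
Proof. by move=> e; rewrite -mulgA (mulgA a) mulgA e mulgA. Qed.

Lemma rot_conj (a b g u : G) : g * u = b * a * g -> a * g * u = a * b * (a * g).
Proof. by move=> e; rewrite -mulgA e !mulgA. Qed.

Lemma cycle_sorted V : cycle nopinch V -> sorted nopinch V.
Proof. by case: V => [//|l V] /=; rewrite rcons_path => /andP[]. Qed.

(* The junctions of V * c are unpinched one letter at a time, rotating V. *)
Lemma elliptic_hyperbolic n c x y f V m : (size c <= n)%N -> pathw y c x ->
  sorted nopinch c -> V != [::] -> pathw y V y -> cycle nopinch V ->
  wv c * A x f * A x m = wv V * (wv c * A x f) -> False.
Proof.
elim: n c y f V => [|n IH] c y f V zc pc sc V0 pV cV e.
  case: c zc pc sc e => // _ /= /eqP <- _; rewrite !mul1g -(gbs_AD gG) => e.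
  have := @word_carry _ _ _ _ _ _ _ gG noc 0%R y y [::] (f + m)%R V f.
  rewrite (A0 gG) !mul1g /= eqxx => H.
  have /carry_size : carry p q 0%R [::] (f + m)%R V f.
    exact: H isT pV isT (cycle_sorted cV) e.
  by move/esym/eqP; rewrite size_eq0 (negbTE V0).
case: (lastP V) V0 pV cV e => [//|V' lv] _ pV cV e.
case: c zc pc sc e => [|lc c'] zc pc sc e.
  have yx : y = x by apply/eqP.
  by apply: (IH [::] y f (rcons V' lv)) => //; case: (V').
(* Without a pinch both sides are reduced, and their numbers of darts differ by the size of [V]. *)
have [np|pn] := boolP (nopinch lv lc).
  have := @word_carry _ _ _ _ _ _ _ gG noc 0%R y x (lc :: c') (f + m)%R
    (rcons V' lv ++ lc :: c') f.
  rewrite (A0 gG) mul1g wval_cat -(mulgA (wv (rcons _ _))) -e (gbs_AD gG) mulgA => H.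
  have /carry_size : carry p q 0%R (lc :: c') (f + m)%R (rcons V' lv ++ lc :: c') f.
    apply: H => //; [exact: pathw_cat pV pc|exact: sorted_rcons_cat (cycle_sorted cV) np sc].
  by rewrite size_cat size_rcons /=; lia.
have [lvy pV'] := rotr_pathw pV.
have [c2 [f2 [p2 s2 z2 e2]]] := pinch_front f pc lvy pn sc.
apply: (IH c2 (dsrc lv.2) f2 (lv :: V')) => //.
- exact: leq_trans z2 _.
- by rewrite -(rot_cycle 1) rot1_cons.
rewrite -e2 (wval_cat A t [:: lv] V'); apply: rot_conj.
by rewrite e -cats1 wval_cat.
Qed.

(* Whenever c is not empty, it can be shortened by rotating U or V: pinch one of
   the junctions of V * c and c * U or, if there is no pinch, compare the first
   letters of these two reduced words. *)
Lemma collins n c x y f U V : (size c <= n)%N -> pathw y c x -> sorted nopinch c ->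
  U != [::] -> pathw x U x -> cycle nopinch U ->
  V != [::] -> pathw y V y -> cycle nopinch V ->
  wv c * A x f * wv U = wv V * (wv c * A x f) ->
  exists v i j z, A v z * wv (rot i U) = wv (rot j V) * A v z.
Proof.
elim: n c x y f U V => [|n IH] c x y f U V zc pc sc U0 pU cU V0 pV cV e.
  case: c zc pc sc e => // _ /= /eqP <- _; rewrite !mul1g => e.
  by exists y, 0%N, 0%N, f; rewrite !rot0.
case: c zc pc sc e => [|lc c'] zc pc sc e.
  have yx : y = x by apply/eqP.
  by apply: (IH [::] x y f U V).
case: (lastP V) V0 pV cV e => [//|V' lv] _ pV cV e.
have [np|pn] := boolP (nopinch lv lc); last first.
  have [lvy pV'] := rotr_pathw pV.
  have [c2 [f2 [p2 s2 z2 e2]]] := pinch_front f pc lvy pn sc.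
  have [||||v [i [j [z eq]]]] := IH c2 x (dsrc lv.2) f2 U (lv :: V') _ p2 s2 U0 pU cU _ pV'.
  - exact: leq_trans z2 _.
  - by [].
  - by rewrite -(rot_cycle 1) rot1_cons.
  - rewrite -e2 (wval_cat A t [:: lv] V'); apply: rot_conj.
    by rewrite e -cats1 wval_cat.
  have [k kE] := rot_rot_ex j (size V') (rcons V' lv).
  exists v, i, k, z; rewrite eq -kE -cats1 rot_size_cat.
  by [].
case: U U0 pU cU e => [//|lu U] _ pU cU e.
move: (pU) => /= /andP[/eqP lux pU'].
have cE : lc :: c' = rcons (belast lc c') (last lc c') by rewrite lastI.
have [np2|pn2] := boolP (nopinch (last lc c') (f + lu.1, lu.2)%R); last first.
  rewrite cE in pc e; have [p2 [f2 e2]] := pinch_back pc lux pn2.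
  have [|||||||||v [i [j [z eq]]]] :=
    IH (belast lc c') (dtgt lu.2) y f2 (rcons U lu) (rcons V' lv) _ p2.
  - by rewrite size_belast.
  - by rewrite cE in sc; exact: sorted_rconsW sc.
  - by case: (U).
  - by rewrite -cats1; apply: pathw_cat pU' _; rewrite /= lux !eqxx.
  - by rewrite -rot1_cons rot_cycle.
  - by case: (V').
  - exact: pV.
  - exact: cV.
  - rewrite -e2 -(cats1 U) wval_cat; apply: rot_conjr.
    by rewrite -(wval_cat A t [:: lu] U).
  have [k kE] := rot_rot_ex i 1 (lu :: U).
  by exists v, k, j, z; rewrite -eq -kE rot1_cons.
have [lv0 [V0 VE]] : exists lv0 V0, rcons V' lv = lv0 :: V0.
  by case: (V') => [|l0 V0]; [exists lv, [::]|exists l0, (rcons V0 lv)].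
have : carry p q 0%R ((lc :: c') ++ (f + lu.1, lu.2)%R :: U) 0%R (rcons V' lv ++ lc :: c') f.
  apply: (@word_carry _ _ _ _ _ _ _ gG noc 0%R y x).
  - by apply: pathw_cat pc _; rewrite /= lux eqxx.
  - exact: pathw_cat pV pc.
  - rewrite cE; apply: sorted_rcons_cat => //; first by rewrite -cE.
    by move: cU; rewrite /= rcons_path => /andP[]; case: (U).
  - exact: sorted_rcons_cat (cycle_sorted cV) np sc.
  rewrite !(A0 gG) mul1g mulg1 !wval_cat -(mulgA (wv (rcons _ _))) -e.
  rewrite -(mulgA (wv (lc :: c'))); congr (_ * _).
  by rewrite !wval_cons [(_, _).1]/= [(_, _).2]/= lux (gbs_AD gG) !mulgA.
rewrite VE => -[dd [k [jk _]]]; rewrite add0r in jk.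
move: (pc) => /= /andP[/eqP lcy pc'].
have := addlP (lab (drev lc.2) * k)%R f pc'; case: addl => c3 f3 /= [p3 e3 s3 z3].
(* The first letters of [c] and [V] differ by a power that crosses their common dart; so [lv0]
   splits off from [c], and [V] is rotated forward. *)
have ge : wv (lc :: c') * A x f = wv [:: lv0] * (wv c3 * A x f3).
  rewrite e3 /= mulg1 -dd jk (gbs_AD gG) !mulgA; congr (_ * _ * _).
  by rewrite -!mulgA; congr (_ * _); rewrite (dart_rel gG).
rewrite VE in pV cV e.
move: (pV) => /= /andP[/eqP lv0y pV0].
have [|||||||||v [i [j [z eq]]]] := IH c3 x (dtgt lc.2) f3 (lu :: U) (rcons V0 lv0) _ p3.
- by rewrite z3.
- by apply: s3; exact: path_sorted sc.
- by [].
- exact: pU.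
- exact: cU.
- by case: (V0).
- by rewrite dd -cats1; apply: pathw_cat pV0 _; rewrite /= lv0y !eqxx.
- by rewrite -rot1_cons rot_cycle.
- apply: (@mulgI _ (wv [:: lv0])); rewrite mulgA -ge e ge.
  by rewrite (wval_cat A t [:: lv0] V0) -cats1 wval_cat !mulgA.
have [k' kE] := rot_rot_ex j 1 (lv0 :: V0).
by exists v, i, k', z; rewrite eq -kE rot1_cons.
Qed.

End WordTheory.

(** * Linear conjugators *)

Section Conjugation.
Variables (Gam : graph_of_groups) (T : {set edge Gam}) (p q : edge Gam -> int).
Variables (G : groupType) (A : vert Gam -> int -> G) (t : edge Gam -> G).
Hypothesis gG : gbs_group T p q A t.
Hypothesis noc : forall c : seq (dart Gam), circuit c ->
  ~ {in c, forall d, d.1 \in T}.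
Hypothesis conT : forall u v, connect (adj T) u v.
Variables (W : G -> nat) (X : seq G).
Hypothesis WX : word_metric W X.
Variable C0 : nat.
Hypothesis tC0 : forall d, (W (tval t d) <= C0)%N.

Local Notation wv := (wval A t).
Local Notation nopinch := (nopinch p q).
Local Notation cost := (cost A W C0).

Lemma reduced_path g x y : exists c f,
  [/\ pathw x c y, sorted nopinch c & g = wv c * A y f].
Proof.
have [w [f [pw ->]]] := path_word gG conT g x y.
by have [c [f' [pc sc <- _ _]]] := reduce_word gG WX tC0 f pw; exists c, f'.
Qed.

(** Along a reduced path word for [g] the relation is a carry, which can be divided by [r]; the same
    [g] conjugates the quotients. *)
Lemma conj_divide g x y r m n : prime r -> (forall e, ~~ (r %| p e)%Z) ->
  (forall e, ~~ (r %| q e)%Z) -> g * A x (r%:Z * m)%R = A y n * g ->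
  exists2 n', n = (r%:Z * n')%R & g * A x m = A y n' * g.
Proof.
move=> pr rp rq; have [c [f [pc sc ->]]] := reduced_path g y x.
rewrite -mulgA -(gbs_AD gG) => /esym e.
have /(carry_divide pr rp rq)[n' -> ca] := word_carry gG noc pc pc sc sc e.
exists n' => //; rewrite -mulgA -(gbs_AD gG).
by rewrite (carry_val gG pc ca).
Qed.

Definition label_primes : seq nat :=
  flatten [seq primes `|p e| ++ primes `|q e| | e <- enum (edge Gam)].

Lemma label_primesP r : prime r -> r \notin label_primes ->
  (forall e, ~~ (r %| p e)%Z) /\ (forall e, ~~ (r %| q e)%Z).
Proof.
move=> pr rS; suff H e : ~~ (r %| p e)%Z && ~~ (r %| q e)%Z.
  by split=> e; have /andP[] := H e.
rewrite -negb_or; apply: contra rS => h; apply/flattenP.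
exists (primes `|p e| ++ primes `|q e|); first by apply/mapP; exists e; rewrite ?mem_enum.
rewrite mem_cat !mem_primes pr !absz_gt0 (gbs_p0 gG) (gbs_q0 gG) /=.
exact: h.
Qed.

Definition shrinks x (m : nat) :=
  exists y n g, g * A x m = A y n * g /\ (`|n| < m)%N.

(** A conjugator that shrinks a bounded divisor [d] of [m] also shrinks [m], by the same ratio; this
    is at most [(d - 1) / d], hence at most [N / N.+1] because [d <= N]. *)
Lemma shrink_bounded : exists N, forall x (m : nat), (0 < m)%N -> shrinks x m ->
  exists g y n, [/\ (W g <= N)%N, g * A x m = A y n * g & (N.+1 * `|n| <= N * m)%N].
Proof.
apply: fin_bound => [N N' x le h m m0 /(h m m0)[g [y [n [Wg e nm]]]]|x].
  by exists g, y, n; split=> //; [exact: leq_trans le|nia].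
have [||B BP] := @dvdn_finite_basis label_primes (shrinks x).
- move=> k m k0 m0 [y [n [g [e nm]]]]; exists y, (n * k%:Z)%R, g; split.
    by rewrite mulnC PoszM; exact: (A_scale gG _ e).
  by rewrite abszM absz_nat mulnC ltn_pmul2l.
- move=> r m pr rS m0 [y [n [g [e nm]]]]; have [rp rq] := label_primesP pr rS.
  rewrite PoszM in e; have [n' n'E e'] := conj_divide pr rp rq e.
  exists y, n', g; split=> //; move: nm; rewrite n'E abszM absz_nat.
  by rewrite ltn_pmul2l // prime_gt0.
have /choice[b bP] (d : nat) : exists N, shrinks x d -> exists g y n,
    [/\ (W g <= N)%N, g * A x d = A y n * g & (`|n| < d)%N].
  have [[y [n [g [e nd]]]]|ns] := pselect (shrinks x d); last by exists 0%N.
  by exists (W g) => _; exists g, y, n.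
exists (B + \max_(d < B.+1) b d)%N => m m0 /(BP m m0)[d [d0 dB dm]] /bP[g [y [n [Wg e nd]]]].
have le : (b d <= \max_(d < B.+1) b d)%N.
  exact: (@leq_bigmax _ (fun d : 'I_B.+1 => b d) (Ordinal (dB : d < B.+1)%N)).
have [k mE] := dvdnP dm; subst m.
exists g, y, (n * k%:Z)%R; split.
- by apply: leq_trans Wg _; apply: leq_trans le _; exact: leq_addl.
- by rewrite mulnC PoszM; exact: (A_scale gG _ e).
rewrite abszM absz_nat mulnA [leqRHS]mulnCA [leqRHS]mulnC leq_mul2r; apply/orP; right.
by move: (\max_(_ < _) _)%N => M; nia.
Qed.

Definition sgb (b : bool) : int := if b then (- 1)%R else 1%R.

(** For fixed endpoints and sign, the exponents [m] that are conjugate to [m] or [-m] satisfy the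
    hypotheses of [dvdn_finite_basis], so conjugators for bounded divisors suffice. *)
Lemma sign_bounded : exists N, forall (i : vert Gam * vert Gam * bool) (m : nat),
  (0 < m)%N ->
  (exists g, g * A i.1.1 m = A i.1.2 (sgb i.2 * m%:Z)%R * g) ->
  exists2 g, (W g <= N)%N & g * A i.1.1 m = A i.1.2 (sgb i.2 * m%:Z)%R * g.
Proof.
apply: fin_bound => [N N' i le h m m0 /(h m m0)[g Wg e]|[[x y] b]] /=.
  by exists g => //; exact: leq_trans le.
pose Q (m : nat) := exists g, g * A x m = A y (sgb b * m%:Z)%R * g.
have [||B BP] := @dvdn_finite_basis label_primes Q.
- move=> k m k0 m0 [g e]; exists g.
  by rewrite mulnC PoszM mulrA; exact: (A_scale gG _ e).
- move=> r m pr rS m0 [g e]; have [rp rq] := label_primesP pr rS.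
  rewrite PoszM mulrCA in e; have [n' n'E e'] := conj_divide pr rp rq e.
  exists g; rewrite e'; congr (A _ _ * _); apply/esym/(mulfI _ n'E).
  by rewrite eqz_nat -lt0n prime_gt0.
have /choice[w wP] (d : nat) : exists N, Q d -> exists2 g,
    (W g <= N)%N & g * A x d = A y (sgb b * d%:Z)%R * g.
  have [[g e]|ns] := pselect (Q d); last by exists 0%N.
  by exists (W g) => _; exists g.
exists (\max_(d < B.+1) w d)%N => m m0 /(BP m m0)[d [d0 dB dm]] /wP[g Wg e].
exists g.
  apply: leq_trans Wg _.
  exact: (@leq_bigmax _ (fun d : 'I_B.+1 => w d) (Ordinal (dB : d < B.+1)%N)).
have [k mE] := dvdnP dm; subst m.
by rewrite mulnC PoszM mulrA; exact: (A_scale gG _ e).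
Qed.

Lemma signP (m : int) : exists b, m = (`|m|%N%:Z * sgb b)%R /\ (`|m|%N%:Z = m * sgb b)%R.
Proof.
by have [m0|m0] := leP 0%R m; [exists false|exists true]; rewrite /sgb; split; lia.
Qed.

Hypothesis expA : exists2 K, (0 < K)%N & forall v m, (`|m| <= K ^ (W (A v m)).+1)%N.

(* Exponents shrink geometrically down to the least one in the conjugacy class,
   and |m| is at most exponential in the length of A x m. *)
Lemma shrink_linear : exists D, forall x m, exists g y n,
  [/\ (W g <= D * (W (A x m)).+2)%N, g * A x m = A y n * g & ~ shrinks y `|n|].
Proof.
have [K K0 KP] := expA; have [N NP] := shrink_bounded.
pose Q k (xm : vert Gam * int) := exists g y n,
  [/\ (W g <= k)%N, g * A xm.1 xm.2 = A y n * g & ~ shrinks y `|n|].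
have triv x m : ~ shrinks x `|m| -> Q N (x, m).
  by move=> ns; exists 1, x, m; rewrite (wm1 WX) mul1g mulg1; split.
have [||D DP] := @descent _ (fun xm => `|xm.2|%N) Q N N K K0.
- move=> [x m] /= m0; apply: triv; rewrite m0 => -[y [n [g [_]]]]; by rewrite ltn0.
- move=> [x m] /=; have [sh|ns] := pselect (shrinks x `|m|); last by left; exact: triv.
  right; have m0 : (0 < `|m|)%N by case: sh => y [n [g [_]]]; exact: leq_ltn_trans.
  have [g [y [n [Wg e le]]]] := NP _ _ m0 sh.
  have [b [mE mE']] := signP m.
  exists (y, (n * sgb b)%R); split.
    by rewrite /= abszM; case: (b); rewrite muln1.
  move=> k [g' [y' [n' [Wg' e' ns]]]]; exists (g' * g), y', n'; split=> //.
    by apply: leq_trans (wmM WX _ _) _; rewrite addnC leq_add.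
  rewrite /= in e' *; rewrite mE -mulgA (A_scale gG (sgb b) e) !mulgA e'.
  by [].
exists D => x m; have [k le [g [y [n [Wg e ns]]]]] := DP _ (x, m) (KP x m).
by exists g, y, n; split=> //; exact: leq_trans Wg le.
Qed.

Lemma elliptic_conj_bound : exists C, forall x y m n g, g * A x m = A y n * g ->
  exists c, c * A x m = A y n * c /\ (W c <= C * (W (A x m) + W (A y n)).+1)%N.
Proof.
have [D DP] := shrink_linear; have [N NP] := sign_bounded.
(* The coefficient 4 covers the two offsets [.+2] in the bounds of [shrink_linear]. *)
exists (4 * D + N)%N => x y m n g e.
have [g1 [x1 [m1 [W1 e1 ns1]]]] := DP x m; have [g2 [y1 [n1 [W2 e2 ns2]]]] := DP y n.
suff [d Wd ed] : exists2 d, (W d <= N)%N & d * A x1 m1 = A y1 n1 * d.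
  exists (g2^-1 * d * g1); split.
    rewrite -mulgA e1 -[in LHS]mulgA (mulgA d) ed.
    by apply: (@mulgI _ g2); rewrite !mulgA mulgV mul1g e2 mulgK.
  have := wmM WX (g2^-1 * d) g1; have := wmM WX g2^-1 d; have := wmV WX g2; lia_lengths W.
pose h := g2 * g * g1^-1.
have eh : h * A x1 m1 = A y1 n1 * h.
  apply: (@mulIg _ g1); rewrite /h -!mulgA mulVg mulg1 -e1 mulKg e.
  by rewrite !mulgA e2.
(* The two exponents are conjugate through [h], so the larger one could be shrunk to the smaller. *)
have eqn : `|m1|%N = `|n1|%N.
  have [b [mE mE']] := signP m1; have [b' [nE nE']] := signP n1.
  have sb c : `|sgb c|%N = 1%N by case: c.
  case: (ltngtP `|m1| `|n1|) => // lt.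
    case: ns2; exists x1, (m1 * sgb b')%R, h^-1; split; last by rewrite abszM sb muln1.
    rewrite nE'; apply: (A_scale gG); apply: (@mulgI _ h).
    by rewrite mulVKg mulgA eh mulgK.
  case: ns1; exists y1, (n1 * sgb b)%R, h; split; last by rewrite abszM sb muln1.
  by rewrite mE'; exact: (A_scale gG _ eh).
have [m0|m0] := posnP `|m1|.
  exists 1; first by rewrite (wm1 WX).
  have -> : m1 = 0%R by lia. have -> : n1 = 0%R by lia.
  by rewrite !(A0 gG).
have [b [mE mE']] := signP m1.
have [b' nE] : exists b', n1 = (sgb b' * m1)%R.
  have [<-|h'] : m1 = n1 \/ n1 = (- m1)%R by lia.
    by exists false; rewrite mul1r.
  by exists true; rewrite mulN1r.
have [|d Wd ed] := NP (x1, y1, b') _ m0.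
  exists h => /=; rewrite mE' mulrA -nE; exact: (A_scale gG _ eh).
exists d => //; move: ed => /= /(A_scale gG (sgb b)).
by rewrite -mulrA -mE nE.
Qed.

Hypothesis vertexA : exists C, forall v g h z, A v z * g = h * A v z ->
  exists z', A v z' * g = h * A v z' /\ (W (A v z') <= C * (W g + W h).+1)%N.

(** Fixed loop words for the generators are concatenated; [addl] merges the power ending one into
    the next without raising the cost. *)
Lemma loop_cost v : exists C, forall g, exists w f,
  [/\ pathw v w v, g = wv w * A v f & (cost w + W (A v f) <= C * W g)%N].
Proof.
have [||C CP] := @seq_bound G X (fun C g => exists w f,
    [/\ pathw v w v, g = wv w * A v f & (cost w + W (A v f) <= C)%N]).
- move=> m n g mn [w [f [pw e c]]]; exists w, f; split=> //; exact: leq_trans mn.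
- move=> g; have [w [f [pw e]]] := path_word gG conT g v v.
  by exists (cost w + W (A v f))%N, w, f.
exists C; apply: (wm_ind WX (P := fun n g => exists w f,
    [/\ pathw v w v, g = wv w * A v f & (cost w + W (A v f) <= C * n)%N])).
  by exists [::], 0%R; rewrite /= eqxx (A0 gG) mulg1 (wm1 WX).
move=> x n g /CP[w1 [f1 [p1 -> c1]]] [w2 [f2 [p2 -> c2]]].
have := addl_cost gG WX C0 f1 f2 p2; have := addlP gG f1 f2 p2.
case: addl => w3 f3 /= [p3 e3 _ _] c3; exists (w1 ++ w3), f3; split.
- exact: pathw_cat p1 p3.
- by rewrite wval_cat -!mulgA e3.
by rewrite cost_cat mulnS; lia_lengths W.
Qed.

(** The rotations in [collins] are undone by prefixes of [U] and [V], which the costs bound; the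
    vertex power between the rotated words is bounded by [vertexA]. *)
Lemma hyperbolic_conj_bound : exists C, forall x y U V g,
  U != [::] -> pathw x U x -> cycle nopinch U ->
  V != [::] -> pathw y V y -> cycle nopinch V ->
  g * wv U = wv V * g ->
  exists c, c * wv U = wv V * c /\ (W c <= C * (cost U + cost V).+1)%N.
Proof.
have [C CP] := vertexA; exists (C + 2)%N => x y U V g U0 pU cU V0 pV cV e.
have [c [f [pc sc gE]]] := reduced_path g y x; rewrite gE in e.
have [v [i [j [z ez]]]] := collins gG noc (leqnn _) pc sc U0 pU cU V0 pV cV e.
have [z' [ez' Wz']] := CP _ _ _ _ ez.
exists (wv (take j V) * A v z' * (wv (take i U))^-1); split.
  apply: (@mulIg _ (wv (take i U))).
  rewrite -!mulgA mulVg mulg1 wval_rot mulKg ez'.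
  by rewrite !mulgA wval_rot.
have ct k L : (W (wv (take k L)) <= cost L)%N.
  apply: leq_trans (wm_wval A WX tC0 _) _.
  by rewrite -{2}(cat_take_drop k L) cost_cat leq_addr.
have cr k L : (W (wv (rot k L)) <= cost L)%N.
  apply: leq_trans (wm_wval A WX tC0 _) _.
  by rewrite -{2}(cat_take_drop k L) !cost_cat addnC.
have le1 : (C * (W (wv (rot i U)) + W (wv (rot j V))).+1 <= C * (cost U + cost V).+1)%N.
  by rewrite leq_mul2l ltnS leq_add ?orbT.
have := wmM WX (wv (take j V) * A v z') (wv (take i U))^-1.
have := wmM WX (wv (take j V)) (A v z'); have := wmV WX (wv (take i U)).
have := ct i U; have := ct j V; move: Wz' le1; rewrite mulnDl.
move: (C * _)%N (C * _)%N => m1 m2; lia_lengths W.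
Qed.

Lemma conj_bound (v0 : vert Gam) : exists C, forall u v g, g * u = v * g ->
  exists c, c * u = v * c /\ (W c <= C * (W u + W v).+1)%N.
Proof.
have [C1 C1P] := loop_cost v0; have [C2 C2P] := elliptic_conj_bound.
have [C3 C3P] := hyperbolic_conj_bound.
(* Passing from [u] to its cyclic form takes a conjugator of length at most [2 * C1 * W u], so
   lengths grow by a factor of at most [4 * C1 + 1]. *)
exists ((4 * C1 + 1) * (C2 + C3 + 1))%N => u v g e.
have [wu [fu [pu uE cu]]] := C1P u; have [wu' [fu' [pv vE cv]]] := C1P v.
have [a [x [Wa xP]]] := cyclic_form gG WX tC0 fu pu.
have [b [y [Wb yP]]] := cyclic_form gG WX tC0 fu' pv.
rewrite -uE in xP; rewrite -vE in yP.
pose h := b^-1 * g * a.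
have conj_h u' v' : u * a = a * u' -> v * b = b * v' -> h * u' = v' * h.
  move=> ua vb; rewrite /h -mulgA -ua mulgA -(mulgA _ g) e !mulgA.
  by congr (_ * _ * _); apply: (@mulgI _ b); rewrite !mulgA mulgV mul1g -vb mulgK.
have fin u' v' c : u * a = a * u' -> v * b = b * v' -> c * u' = v' * c ->
    b * c * a^-1 * u = v * (b * c * a^-1).
  move=> ua vb ec; apply: (@mulIg _ a); rewrite -!mulgA ua mulKg mulVg mulg1.
  by rewrite ec !mulgA vb.
have Wfin c : (W (b * c * a^-1) <= W b + W c + W a)%N.
  by have := wmM WX (b * c) a^-1; have := wmM WX b c; have := wmV WX a; lia_lengths W.
have Wconj u1 a1 u' : u1 * a1 = a1 * u' -> (W u' <= W u1 + 2 * W a1)%N.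
  move=> e1; have -> : u' = a1^-1 * (u1 * a1) by rewrite e1 mulKg.
  by have := wmM WX a1^-1 (u1 * a1); have := wmM WX u1 a1; have := wmV WX a1; lia_lengths W.
have ar wu1 wv1 wa wb x1 x2 wc D : (wa <= 2 * (C1 * wu1) -> wb <= 2 * (C1 * wv1) ->
    x1 <= (4 * C1 + 1) * wu1 -> x2 <= (4 * C1 + 1) * wv1 ->
    wc <= D * (x1 + x2).+1 -> D <= C2 + C3 ->
    wb + wc + wa <= (4 * C1 + 1) * (C2 + C3 + 1) * (wu1 + wv1).+1)%N.
  move=> h1 h2 h3 h4 h5 h6.
  have h7 : (wc <= (C2 + C3) * ((4 * C1 + 1) * (wu1 + wv1).+1))%N.
    by apply: leq_trans h5 _; apply: leq_mul => //; nia.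
  by rewrite mulnDr muln1 mulnDl [(_ * (C2 + C3))%N]mulnC -mulnA; nia.
have {}Wa : (W a <= 2 * (C1 * W u))%N by apply: leq_trans Wa _; rewrite leq_mul2l.
have {}Wb : (W b <= 2 * (C1 * W v))%N by apply: leq_trans Wb _; rewrite leq_mul2l.
case: xP yP => [[m um]|[U [U0 pU cU eU kU]]] [[n vn]|[V [V0 pV cV eV kV]]].
- have [c [ec Wc]] := C2P _ _ _ _ _ (conj_h _ _ um vn).
  exists (b * c * a^-1); split; first exact: fin um vn ec.
  apply: leq_trans (Wfin c) _.
  apply: (ar _ _ _ _ (W (A x m)) (W (A y n)) _ C2) => //; try nia.
  + by have := Wconj _ _ _ um; nia.
  + by have := Wconj _ _ _ vn; nia.
- have [c [f [pc sc hE]]] := reduced_path h y x.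
  case: (elliptic_hyperbolic gG noc (m := m) (f := f) (leqnn _) pc sc V0 pV cV).
  by rewrite -hE; exact: conj_h.
- have [c [f [pc sc hE]]] := reduced_path h^-1 x y.
  case: (elliptic_hyperbolic gG noc (m := n) (f := f) (leqnn _) pc sc U0 pU cU).
  rewrite -hE; apply: (@mulgI _ h); rewrite mulVKg mulgA (conj_h _ _ eU vn).
  by rewrite mulgK.
have [c [ec Wc]] := C3P _ _ _ _ _ U0 pU cU V0 pV cV (conj_h _ _ eU eV).
exists (b * c * a^-1); split; first exact: fin eU eV ec.
apply: leq_trans (Wfin c) _.
by apply: (ar _ _ _ _ (cost U) (cost V) _ C3) => //; nia.
Qed.

End Conjugation.

(** * The fundamental group and its word length *)

Section PresentedClasses.
Variables (Y : choiceType) (R : set (word Y)).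

Lemma word_class_cat w1 w2 : word_class R (w1 ++ w2) = word_class R w1 * word_class R w2.
Proof. by rewrite [RHS]presented_mulE. Qed.

Lemma word_class_winv w : word_class R (winv w) = (word_class R w)^-1.
Proof.
apply: (@mulgI _ (word_class R w)); rewrite mulgV -word_class_cat.
by apply/word_classP; exact: pres_mulwV.
Qed.

Lemma word_class_rel w1 w2 : R (w1 ++ winv w2) -> word_class R w1 = word_class R w2.
Proof.
move/pres_relator/word_classP; rewrite word_class_cat word_class_winv => e.
exact: divg1_eq.
Qed.

End PresentedClasses.

Lemma int_morph_eq (H : groupType) (f g : int -> H) :
  {morph f : m n / (m + n)%R >-> m * n} -> {morph g : m n / (m + n)%R >-> m * n} ->
  f 1%R = g 1%R -> f =1 g.
Proof.
move=> fD gD fg1.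
have f0 : f 0%R = 1 by apply: (@mulgI _ (f 0%R)); rewrite -fD addr0 mulg1.
have g0 : g 0%R = 1 by apply: (@mulgI _ (g 0%R)); rewrite -gD addr0 mulg1.
elim/int_ind => [|n IH|n IH]; first by rewrite f0.
  by rewrite intS fD gD fg1 IH.
have fN : f (- 1)%R = g (- 1)%R.
  by apply: (@mulgI _ (f 1%R)); rewrite -fD fg1 -gD subrr f0 g0.
by rewrite intS opprD fD gD fN IH.
Qed.

Section Pi1.
Variable Gam : graph_of_groups.
Hypotheses (vgrp_Z : forall v : vert Gam, infinite_cyclic (vgrp v))
  (egrp_Z : forall e : edge Gam, infinite_cyclic (egrp e)).

(** With generators chosen for all vertex and edge groups, [p e] and [q e] are the exponents of the
    two images of the generator of the edge group; they are nonzero because the embeddings are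
    injective. *)
Lemma pi1_gbs_group (T : {set edge Gam}) : exists p q A t, @gbs_group Gam T p q (pi1 T) A t.
Proof.
pose zv v := s2val (cid2 (vgrp_Z v)); pose ze e := s2val (cid2 (egrp_Z e)).
have zvb v : bijective (zv v) := s2valP (cid2 (vgrp_Z v)).
have zeb e : bijective (ze e) := s2valP (cid2 (egrp_Z e)).
have zvD v : {morph zv v : m n / (m + n)%R >-> m * n} := s2valP' (cid2 (vgrp_Z v)).
have zeD e : {morph ze e : m n / (m + n)%R >-> m * n} := s2valP' (cid2 (egrp_Z e)).
have zv0 v : zv v 0%R = 1 by apply: (@mulgI _ (zv v 0%R)); rewrite -zvD addr0 mulg1.
have ze0 e : ze e 0%R = 1 by apply: (@mulgI _ (ze e 0%R)); rewrite -zeD addr0 mulg1.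
have scaleD v (k : int) : {morph (fun m => zv v (k * m)%R) : m n / (m + n)%R >-> m * n}.
  by move=> m n; rewrite mulrDr zvD.
have label (e : edge Gam) v (emb : egrp e -> vgrp v) : {morph emb : a b / a * b} ->
    injective emb -> exists k : int, k != 0%R /\ forall m, emb (ze e m) = zv v (k * m)%R.
  move=> embM embI; have [zi zK ziK] := zvb v; exists (zi (emb (ze e 1%R))).
  set k := zi _; have kE : zv v k = emb (ze e 1%R) by rewrite ziK.
  split.
    apply/eqP => k0.
    have emb1 : emb 1 = 1 by apply: (@mulgI _ (emb 1)); rewrite -embM !mulg1.
    by move: kE; rewrite k0 zv0 -emb1 => /embI; rewrite -(ze0 e) => /(bij_inj (zeb e)).
  apply: (int_morph_eq (f := fun m => emb (ze e m)) _ (scaleD v k)).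
    by move=> m n; rewrite zeD embM.
  by rewrite mulr1 kE.
have /choice[p pP] e := label e _ _ (@emb_srcM Gam e) (@emb_src_inj Gam e).
have /choice[q qP] e := label e _ _ (@emb_tgtM Gam e) (@emb_tgt_inj Gam e).
pose R := pi1_rel (Gam := Gam) T.
pose A v m : pi1 T := word_class R [:: vletter (zv v m)].
pose t e : pi1 T := word_class R [:: eletter e false].
exists p, q, A, t; split.
- by move=> e; have [] := pP e.
- by move=> e; have [] := qP e.
- move=> v m n; rewrite /A -word_class_cat zvD; apply/esym/word_class_rel.
  exact: pi1_vertex.
- move=> e k; have [_ pE] := pP e; have [_ qE] := qP e.
  have := word_class_rel (@pi1_edge Gam T e (ze e k)); rewrite pE qE -/(A _ _) => <-.
  rewrite -[_ :: _](cat1s _ [:: vletter _; _]) word_class_cat.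
  rewrite -(cat1s (vletter _)) word_class_cat.
  rewrite -/(t e) -/(A _ _) -[X in word_class _ X]/(winv [:: eletter e false]).
  by rewrite word_class_winv -/(t e) mulgA mulgVK.
- move=> e eT; apply/word_classP; apply: pres_relator; exact: pi1_tree.
- move=> Q Q1 QM QV QA Qt g; rewrite -(presented_reprK g).
  elim: (presented_repr g) => [|[x b] w IH]; first exact: Q1.
  rewrite -cat1s word_class_cat; apply: QM IH.
  have Qx : Q (word_class R [:: (x, false)]).
    case: x => [[v h]|e]; last exact: Qt.
    by have [zi _ ziK] := zvb v; have := QA v (zi h); rewrite /A ziK.
  case: b => //; rewrite -[[:: _]]/(winv [:: (x, false)]) word_class_winv.
  exact: QV.
move=> H a s aD sa sT.
have zi_ex v : exists f, cancel (zv v) f /\ cancel f (zv v).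
  by have [f zK Kz] := zvb v; exists f.
pose zi v := sval (cid (zi_ex v)).
have zvK v : cancel (zv v) (zi v) := (svalP (cid (zi_ex v))).1.
have ziK v : cancel (zi v) (zv v) := (svalP (cid (zi_ex v))).2.
have ziD v (g h : vgrp v) : zi v (g * h) = (zi v g + zi v h)%R.
  by rewrite -{1}(ziK v g) -{1}(ziK v h) -zvD zvK.
pose phi (x : pi1_gen Gam) : H :=
  match x with inl vg => a (tag vg) (zi _ (tagged vg)) | inr e => s e end.
have phiR r : R r -> word_val phi r = 1.
  case=> [v g h|e b|e eT]; rewrite ?word_val_cat ?word_val_winv /= /letter_val /= ?mulg1.
  - by rewrite ziD aD mulgV.
  - have [m <-] : exists m, ze e m = b by have [f _ Kf] := zeb e; exists (f b).
    have [_ ->] := pP e; have [_ ->] := qP e.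
    by rewrite !zvK !mulgA sa mulgK mulgV.
  - exact: sT.
exists (presented_hom phi); split.
- exact: presented_homM phiR.
- move=> v m; rewrite (presented_homE phiR) /= /letter_val /= mulg1.
  by rewrite zvK.
- by move=> e; rewrite (presented_homE phiR) /= /letter_val /= mulg1.
Qed.

End Pi1.

Section WordLength.
Variables (G : groupType) (P : fin_presentation G).
Local Notation ev := (@weval G P).

Lemma weval_cat w1 w2 : ev (w1 ++ w2) = ev w1 * ev w2.
Proof. by have [hM _] := pres_map_iso P; rewrite /weval word_class_cat hM. Qed.

Lemma weval_nil : ev [::] = 1.
Proof. by apply: (@mulgI _ (ev [::])); rewrite -weval_cat mulg1. Qed.

Lemma weval_winv w : ev (winv w) = (ev w)^-1.
Proof.
apply: (@mulgI _ (ev w)); rewrite mulgV -weval_cat -weval_nil /weval.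
by congr (pres_map _); apply/word_classP; exact: pres_mulwV.
Qed.

Lemma wlen_word_metric :
  word_metric (wlen P) [seq ev [:: l] | l <- enum {: 'I_(ngens P) * bool}].
Proof.
have le w : (wlen P (ev w) <= size w)%N by have [_] := wlenP P (ev w); apply.
split.
- by apply/eqP; rewrite -leqn0 -weval_nil; exact: le.
- move=> g h; have [[w1 <- <-] _] := wlenP P g; have [[w2 <- <-] _] := wlenP P h.
  by rewrite -weval_cat -size_cat.
- move=> g; have [[w <- <-] _] := wlenP P g; rewrite -weval_winv.
  by apply: leq_trans (le _) _; rewrite size_map size_rev.
move=> Q Q1 QS g; have [[w <- <-] _] := wlenP P g.
elim: w => [|l w IH]; first by rewrite weval_nil.
rewrite -cat1s weval_cat; apply: QS IH.
by apply/mapP; exists l; rewrite ?mem_enum.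
Qed.

End WordLength.

Theorem theorem2 (Gam : graph_of_groups)
  (Gam_connected : graph_connected Gam)
  (vgrp_Z : forall v : vert Gam, infinite_cyclic (vgrp v))
  (egrp_Z : forall e : edge Gam, infinite_cyclic (egrp e))
  (T : {set edge Gam}) (T_tree : spanning_tree T)
  (P : fin_presentation (pi1 T)) :
  fun_simeq (CL P) (fun n => n).
Proof.
have [[[v0] conT] noc] := T_tree.
have [p [q [A [t gG]]]] := pi1_gbs_group vgrp_Z egrp_Z T.
have WX := wlen_word_metric P.
have [||C0 tC0] := @fin_bound (dart Gam) (fun C d => (wlen P (tval t d) <= C)%N).
- by move=> m n d mn h; exact: leq_trans mn.
- by move=> d; exists (wlen P (tval t d)).
have [s [lam [cc [[s0 lam1 lam0] lamM ccM lamA ccA]]]] := affine_representation gG noc.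
have expA := exponent_growth WX s0 lam1 lamM ccM ccA.
have vertexA := vertex_conj_bound_uniform gG conT WX s0 lam1 lam0 lamM ccM lamA ccA.
have [C CP] := conj_bound gG noc conT WX tC0 expA vertexA v0.
(* The lower bound is absorbed by the linear term in the definition of [fun_preceq]. *)
split; last by exists 1%N => // n; lia.
exists C.+1 => // n; have [[u [v [cuv le_n <-]]] _] := CLP P n.
have [g ge] := cuv; have [|c [ec Wc]] := CP u v g.
  by rewrite -ge mulgVK.
have [_ le_c] := conj_lenP P cuv.
apply: leq_trans (le_c c _) _; first by rewrite ec mulgK.
apply: leq_trans Wc _; nia.
Qed.
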